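(* For all $y\in\mathbb R^2$ and $x\in\Delta$, $$(1+y^Tx)^3=\sum_{i=1}^{28}\psi_i(y)B_i(x),$$ where, writing $\ell_p(y):=1+y^Tp$ for a point $p\in\mathbb R^2$, $\psi_1=\ell_{p_1}^3$, $\psi_2=\ell_{p_2}^3$, $\psi_3=\ell_{p_3}^3$, $\psi_4=\ell_{p_1}^2\ell_{p_{3,1}}$, $\psi_5=\ell_{p_1}^2\ell_{p_{2,1}}$, $\psi_6=\ell_{p_2}^2\ell_{p_{1,2}}$, $\psi_7=\ell_{p_2}^2\ell_{p_{3,2}}$, $\psi_8=\ell_{p_3}^2\ell_{p_{2,3}}$, $\psi_9=\ell_{p_3}^2\ell_{p_{1,3}}$, $\psi_{10}=\ell_{p_1}\ell_{p_{3,1}}\ell_{p_{3,2}}$, $\psi_{11}=\ell_{p_1}\ell_{p_{2,3}}\ell_{p_{2,1}}$, $\psi_{12}=\ell_{p_2}\ell_{p_{1,2}}\ell_{p_{1,3}}$, $\psi_{13}=\ell_{p_2}\ell_{p_{3,1}}\ell_{p_{3,2}}$, $\psi_{14}=\ell_{p_3}\ell_{p_{2,3}}\ell_{p_{2,1}}$, $\psi_{15}=\ell_{p_3}\ell_{p_{1,2}}\ell_{p_{1,3}}$, $\psi_{16}=\ell_{p_1}\ell_{p_{3,1}}\ell_{p_{2,1}}$, $\psi_{17}=\ell_{p_2}\ell_{p_{3,2}}\ell_{p_{1,2}}$, $\psi_{18}=\ell_{p_3}\ell_{p_{1,3}}\ell_{p_{2,3}}$, $\psi_{19}=\ell_{p_{3,1}}\ell_{p_{3,2}}\ell_{m_1}$,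 $\psi_{20}=\ell_{p_{1,2}}\ell_{p_{1,3}}\ell_{m_2}$, $\psi_{21}=\ell_{p_{2,3}}\ell_{p_{2,1}}\ell_{m_3}$, $\psi_{22}=\ell_{p_{3,1}}\ell_{p_{3,2}}\ell_{p_{2,1}}$, $\psi_{23}=\ell_{p_{3,1}}\ell_{p_{2,3}}\ell_{p_{2,1}}$, $\psi_{24}=\ell_{p_{3,2}}\ell_{p_{1,2}}\ell_{p_{1,3}}$, $\psi_{25}=\ell_{p_{3,1}}\ell_{p_{3,2}}\ell_{p_{1,2}}$, $\psi_{26}=\ell_{p_{1,3}}\ell_{p_{2,3}}\ell_{p_{2,1}}$, $\psi_{27}=\ell_{p_{1,2}}\ell_{p_{1,3}}\ell_{p_{2,3}}$, $\psi_{28}=\ell_q\Big[2\ell_q^2-\tfrac13\big(\ell_{p_{1,3}}\ell_{p_{2,3}}+\ell_{p_{3,2}}\ell_{p_{1,2}}+\ell_{p_{3,1}}\ell_{p_{2,1}}\big)\Big]$, with $m_1=\tfrac25p_1+\tfrac25p_2+\tfrac15p_3$, $m_2=\tfrac15p_1+\tfrac25p_2+\tfrac25p_3$, $m_3=\tfrac25p_1+\tfrac15p_2+\tfrac25p_3$, $q=\tfrac13(p_1+p_2+p_3)$.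
   Context: Let $\Delta=\langle p_1,p_2,p_3\rangle\subset\mathbb R^2$ be a nondegenerate triangle with area $|\Delta|$. Define $p_{1,2}=\tfrac23p_2+\tfrac13p_3$, $p_{1,3}=\tfrac13p_2+\tfrac23p_3$, $p_{2,1}=\tfrac23p_1+\tfrac13p_3$, $p_{2,3}=\tfrac13p_1+\tfrac23p_3$, $p_{3,1}=\tfrac23p_1+\tfrac13p_2$, $p_{3,2}=\tfrac13p_1+\tfrac23p_2$. Simplex splines: for a multiset $\Xi=\{\xi_1,\dots,\xi_6\}\subset\mathbb R^2$ with convex hull of positive area, choose any simplex $\sigma=\langle\bar\xi_1,\dots,\bar\xi_6\rangle\subset\mathbb R^5$ of positive volume projecting (onto the first two coordinates, $\pi$) to the $\xi_i$, and set $M_\Xi(x)=\mathrm{vol}_3(\sigma\cap\pi^{-1}(x))/\mathrm{vol}_5(\sigma)$. $B_i=w_iM_{\Xi_i}$ (on $\Delta$, boundary values by continuity from the interior) with $\Xi_1=\{p_1^{(4)},p_{3,1},p_{2,1}\}$, $\Xi_2=\{p_2^{(4)},p_{3,2},p_{1,2}\}$, $\Xi_3=\{p_3^{(4)},p_{1,3},p_{2,3}\}$, $\Xi_4=\{p_1^{(3)},p_{3,1},p_{3,2},p_{2,1}\}$, $\Xi_5=\{p_1^{(3)},p_{2,1},p_{2,3},p_{3,1}\}$, $\Xi_6=\{p_2^{(3)},p_{1,2},p_{1,3},p_{3,2}\}$, $\Xi_7=\{p_2^{(3)},p_{3,2},p_{3,1},p_{1,2}\}$, $\Xi_8=\{p_3^{(3)},p_{2,3},p_{2,1},p_{1,3}\}$,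 $\Xi_9=\{p_3^{(3)},p_{1,3},p_{1,2},p_{2,3}\}$, $\Xi_{10}=\{p_1^{(2)},p_{3,1},p_{3,2},p_2,p_{2,1}\}$, $\Xi_{11}=\{p_1^{(2)},p_{2,1},p_{2,3},p_3,p_{3,1}\}$, $\Xi_{12}=\{p_2^{(2)},p_{1,2},p_{1,3},p_3,p_{3,2}\}$, $\Xi_{13}=\{p_2^{(2)},p_{3,2},p_{3,1},p_1,p_{1,2}\}$, $\Xi_{14}=\{p_3^{(2)},p_{2,3},p_{2,1},p_1,p_{1,3}\}$, $\Xi_{15}=\{p_3^{(2)},p_{1,3},p_{1,2},p_2,p_{2,3}\}$, $\Xi_{16}=\{p_1^{(2)},p_{3,1},p_{3,2},p_{2,1},p_{2,3}\}$, $\Xi_{17}=\{p_2^{(2)},p_{3,2},p_{3,1},p_{1,2},p_{1,3}\}$, $\Xi_{18}=\{p_3^{(2)},p_{1,3},p_{1,2},p_{2,3},p_{2,1}\}$, $\Xi_{19}=\{p_1,p_2,p_{3,1},p_{3,2},p_{2,1},p_{1,2}\}$, $\Xi_{20}=\{p_2,p_3,p_{1,2},p_{1,3},p_{3,2},p_{2,3}\}$, $\Xi_{21}=\{p_3,p_1,p_{2,3},p_{2,1},p_{1,3},p_{3,1}\}$, $\Xi_{22}=\{p_1,p_{3,1},p_{3,2},p_{1,2},p_{2,3},p_{2,1}\}$, $\Xi_{23}=\{p_1,p_{2,1},p_{2,3},p_{1,3},p_{3,2},p_{3,1}\}$, $\Xi_{24}=\{p_2,p_{1,2},p_{1,3},p_{2,3},p_{3,1},p_{3,2}\}$,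 $\Xi_{25}=\{p_2,p_{3,1},p_{3,2},p_{1,2},p_{1,3},p_{2,1}\}$, $\Xi_{26}=\{p_3,p_{2,3},p_{2,1},p_{3,1},p_{1,2},p_{1,3}\}$, $\Xi_{27}=\{p_3,p_{1,2},p_{1,3},p_{2,3},p_{2,1},p_{3,2}\}$, $\Xi_{28}=\{p_{3,1},p_{3,2},p_{1,2},p_{1,3},p_{2,3},p_{2,1}\}$ (superscript $(m)$ = multiplicity $m$), and $w_i=\frac{|\Delta|}{15}c_i$, $c=(\tfrac16^{\times3},\tfrac13^{\times6},\tfrac12^{\times6},\tfrac23^{\times3},\tfrac56^{\times3},\tfrac23^{\times6},1)$. *)

(* Defs.v *)
From mathcomp Require Import all_boot all_order all_algebra.
From mathcomp Require Import all_classical all_reals all_analysis.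
From Stdlib Require Import ClassicalEpsilon.
Import GRing.Theory Num.Theory numFieldNormedType.Exports.

Set Implicit Arguments.
Unset Strict Implicit.
Unset Printing Implicit Defensive.

Local Open Scope ring_scope.
Local Open Scope classical_set_scope.

Section SimplexSplines.
Context {R : realType}.

Definition padd (p q : R * R) : R * R := (p.1 + q.1, p.2 + q.2).
Definition pscale (a : R) (p : R * R) : R * R := (a * p.1, a * p.2).
Definition comb2 (a b : R) (p q : R * R) : R * R := padd (pscale a p) (pscale b q).
Definition comb3 (a b c : R) (p q r : R * R) : R * R :=
  padd (pscale a p) (padd (pscale b q) (pscale c r)).

Definition dot (y x : R * R) : R := y.1 * x.1 + y.2 * x.2.
Definition ell (p : R * R) (y : R * R) : R := 1 + dot y p.

Definition triangle (p1 p2 p3 : R * R) : set (R * R) :=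
  [set x | exists a b c : R, [/\ 0 <= a, 0 <= b, 0 <= c, a + b + c = 1
                                & x = comb3 a b c p1 p2 p3]].

Definition tri_area (p1 p2 p3 : R * R) : R :=
  `|(p2.1 - p1.1) * (p3.2 - p1.2) - (p3.1 - p1.1) * (p2.2 - p1.2)| / 2.

(* R^5 is represented as (R*R) * ((R*R)*R); the projection pi onto the
   first two coordinates is the first component. *)
Definition leb := (@lebesgue_measure R).

Definition vol3 (S : set ((R * R) * R)) : \bar R :=
  ((leb \x leb) \x leb)%E S.
Definition vol5 (S : set ((R * R) * ((R * R) * R))) : \bar R :=
  ((leb \x leb) \x ((leb \x leb) \x leb))%E S.

Definition simplex5 (xi : 'I_6 -> R * R) (z : 'I_6 -> (R * R) * R)
  : set ((R * R) * ((R * R) * R)) :=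
  [set w | exists lam : 'I_6 -> R,
     [/\ forall i, 0 <= lam i, \sum_i lam i = 1,
         w.1 = (\sum_i lam i * (xi i).1, \sum_i lam i * (xi i).2)
       & w.2 = ((\sum_i lam i * (z i).1.1, \sum_i lam i * (z i).1.2),
                \sum_i lam i * (z i).2)]].

Definition lift_ok (xi : 'I_6 -> R * R) (z : 'I_6 -> (R * R) * R) : Prop :=
  (0 < vol5 (simplex5 xi z))%E.

Definition chosen_lift (xi : 'I_6 -> R * R) : 'I_6 -> (R * R) * R :=
  epsilon (inhabits (fun _ => ((0, 0), 0))) (lift_ok xi).

Definition simplex_spline (xi : 'I_6 -> R * R) (x : R * R) : R :=
  let z := chosen_lift xi in
  fine (vol3 [set u | simplex5 xi z (x, u)]) / fine (vol5 (simplex5 xi z)).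

(* a multiset of 6 knots, listed with multiplicity *)
Definition knots6 (s : seq (R * R)) : 'I_6 -> R * R :=
  fun i => nth (0, 0) s i.

(* w * M_Xi restricted to the closed set D: values on the interior, and
   boundary values by continuity (limit) from the interior *)
Definition restrict_cont (D : set (R * R)) (f : R * R -> R) (x : R * R) : R :=
  if `[< interior D x >] then f x
  else lim (f @ within (interior D) (nbhs x)).

Section Data.
Variables p1 p2 p3 : R * R.

Definition p12 := comb2 (2/3) (1/3) p2 p3.
Definition p13 := comb2 (1/3) (2/3) p2 p3.
Definition p21 := comb2 (2/3) (1/3) p1 p3.
Definition p23 := comb2 (1/3) (2/3) p1 p3.
Definition p31 := comb2 (2/3) (1/3) p1 p2.
Definition p32 := comb2 (1/3) (2/3) p1 p2.

Definition m1 := comb3 (2/5) (2/5) (1/5) p1 p2 p3.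
Definition m2 := comb3 (1/5) (2/5) (2/5) p1 p2 p3.
Definition m3 := comb3 (2/5) (1/5) (2/5) p1 p2 p3.
Definition qc := comb3 (1/3) (1/3) (1/3) p1 p2 p3.

Definition Xis : seq (seq (R * R)) :=
  [:: [:: p1; p1; p1; p1; p31; p21];
      [:: p2; p2; p2; p2; p32; p12];
      [:: p3; p3; p3; p3; p13; p23];
      [:: p1; p1; p1; p31; p32; p21];
      [:: p1; p1; p1; p21; p23; p31];
      [:: p2; p2; p2; p12; p13; p32];
      [:: p2; p2; p2; p32; p31; p12];
      [:: p3; p3; p3; p23; p21; p13];
      [:: p3; p3; p3; p13; p12; p23];
      [:: p1; p1; p31; p32; p2; p21];
      [:: p1; p1; p21; p23; p3; p31];
      [:: p2; p2; p12; p13; p3; p32];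
      [:: p2; p2; p32; p31; p1; p12];
      [:: p3; p3; p23; p21; p1; p13];
      [:: p3; p3; p13; p12; p2; p23];
      [:: p1; p1; p31; p32; p21; p23];
      [:: p2; p2; p32; p31; p12; p13];
      [:: p3; p3; p13; p12; p23; p21];
      [:: p1; p2; p31; p32; p21; p12];
      [:: p2; p3; p12; p13; p32; p23];
      [:: p3; p1; p23; p21; p13; p31];
      [:: p1; p31; p32; p12; p23; p21];
      [:: p1; p21; p23; p13; p32; p31];
      [:: p2; p12; p13; p23; p31; p32];
      [:: p2; p31; p32; p12; p13; p21];
      [:: p3; p23; p21; p31; p12; p13];
      [:: p3; p12; p13; p23; p21; p32];
      [:: p31; p32; p12; p13; p23; p21]].

Definition cs : seq R :=
  [:: 1/6; 1/6; 1/6;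
      1/3; 1/3; 1/3; 1/3; 1/3; 1/3;
      1/2; 1/2; 1/2; 1/2; 1/2; 1/2;
      2/3; 2/3; 2/3;
      5/6; 5/6; 5/6;
      2/3; 2/3; 2/3; 2/3; 2/3; 2/3;
      1].

Definition wt (i : nat) : R := tri_area p1 p2 p3 / 15 * nth 0 cs i.

(* B_{i+1} (0-based index i) on Delta *)
Definition Bsp (i : nat) (x : R * R) : R :=
  restrict_cont (triangle p1 p2 p3)
    (fun x' => wt i * simplex_spline (knots6 (nth [::] Xis i)) x') x.

Definition psis : seq (R * R -> R) :=
  [:: (fun y => ell p1 y ^+ 3);
      (fun y => ell p2 y ^+ 3);
      (fun y => ell p3 y ^+ 3);
      (fun y => ell p1 y ^+ 2 * ell p31 y);
      (fun y => ell p1 y ^+ 2 * ell p21 y);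
      (fun y => ell p2 y ^+ 2 * ell p12 y);
      (fun y => ell p2 y ^+ 2 * ell p32 y);
      (fun y => ell p3 y ^+ 2 * ell p23 y);
      (fun y => ell p3 y ^+ 2 * ell p13 y);
      (fun y => ell p1 y * ell p31 y * ell p32 y);
      (fun y => ell p1 y * ell p23 y * ell p21 y);
      (fun y => ell p2 y * ell p12 y * ell p13 y);
      (fun y => ell p2 y * ell p31 y * ell p32 y);
      (fun y => ell p3 y * ell p23 y * ell p21 y);
      (fun y => ell p3 y * ell p12 y * ell p13 y);
      (fun y => ell p1 y * ell p31 y * ell p21 y);
      (fun y => ell p2 y * ell p32 y * ell p12 y);
      (fun y => ell p3 y * ell p13 y * ell p23 y);
      (fun y => ell p31 y * ell p32 y * ell m1 y);
      (fun y => ell p12 y * ell p13 y * ell m2 y);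
      (fun y => ell p23 y * ell p21 y * ell m3 y);
      (fun y => ell p31 y * ell p32 y * ell p21 y);
      (fun y => ell p31 y * ell p23 y * ell p21 y);
      (fun y => ell p32 y * ell p12 y * ell p13 y);
      (fun y => ell p31 y * ell p32 y * ell p12 y);
      (fun y => ell p13 y * ell p23 y * ell p21 y);
      (fun y => ell p12 y * ell p13 y * ell p23 y);
      (fun y => ell qc y * (2 * ell qc y ^+ 2
          - 1/3 * (ell p13 y * ell p23 y + ell p32 y * ell p12 y
                   + ell p31 y * ell p21 y)))].

Definition psi (i : nat) (y : R * R) : R := nth (fun _ => 0) psis i y.

End Data.
End SimplexSplines.

(* Main.v *)
(* Substituting x into a representation x = sum lambda_i xi_i eliminates three of the six
   weights, so the slice of any admissible simplex over x is an affine image of one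
   three-dimensional polytope depending only on the knots: M(x) = 120 vol(fiber) / |D|,
   where D is the determinant of the three eliminated knots. If xi = al a + be b, the plane
   al lambda_b = be lambda_a cuts this polytope into the ones of the knot lists in which
   xi replaces a or b, which is knot insertion,
     M[a, b, t, ...] = al M[xi, b, t, ...] + be M[a, xi, t, ...],
   for x off the line through xi and t, on which the two pieces could coincide. Explicit
   integer combinations of such relations express the ten cubic Bernstein polynomials,
   themselves simplex splines with knots at the vertices, through B_1, ..., B_28;
   expanding (1 + y^T x)^3 in the Bernstein basis gives the identity for generic x. The
   polytopes move by translating their faces, so the splines are Lipschitz on the triangle
   up to its boundary, and the identity follows everywhere by continuity. *)

From HB Require Import structures.
Require Import Defs.
From mathcomp Require Import all_boot all_order all_algebra fingroup perm.
From mathcomp Require Import all_classical all_reals all_analysis.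
From mathcomp Require Import measurable_realfun ring lra.
Import Order.TTheory GRing.Theory Num.Theory numFieldNormedType.Exports.

Set Implicit Arguments.
Unset Strict Implicit.
Unset Printing Implicit Defensive.

Local Open Scope classical_set_scope.
Local Open Scope ring_scope.

(** * Lebesgue measure on R^3 under affine maps *)

Section AffineMeasure.
Context {R : realType}.
Local Notation mR := (measurableTypeR R).
Local Notation mu := (@lebesgue_measure R).

(** The knots come as a list and the lift is picked by an epsilon operator, so neither the order of
    the knots nor the lift can be assumed convenient. The quotient of volumes is therefore computed
    for an arbitrary admissible lift, whose determinant cancels between slice and total volume;
    invariance under reordering follows. This freedom of order is used everywhere: insertion needs
    an affinely independent leading triple, formal cancellation needs sorted lists, and continuity
    needs a leading triple for which no face constraint jumps. The number 120 is 5!, from the volume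
    of the standard 5-simplex. The coefficients of the Bernstein splines in the 28 splines are not a
    free choice: each is [c_i] times a coefficient of [psi_i] as a polynomial in the three vertex
    forms, up to a fixed scale. What needs a certificate is that these expansions hold. A
    certificate is a list of insertions whose formal sum is compared with the expansion over the
    integers, independently of the triangle; the dihedral symmetry leaves three of them. *)

Lemma leb_affine (k h : R) (S : set mR) : k != 0 -> measurable S ->
  mu ((fun z : mR => (k * z + h : mR)) @^-1` S) = ((`|k|^-1)%:E * mu S)%E.
Proof.
move=> k0 mS; pose f (z : mR) : mR := k * z + h.
have mf : measurable_fun setT f.
  by apply: measurable_funD => //; apply: measurable_funM.
have nk : 0 < `|k| by rewrite normr_gt0.
(* Lebesgue measure is determined by its values on half-open intervals, so it suffices that the
   rescaled pushforward gives these their length. For negative [k] the preimage is half-open at the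
   other end. *)
have E : lebesgue_measure S
    = mscale (NngNum (ltW nk)) (pushforward (@lebesgue_measure R) f) S.
  move=> m; apply: lebesgue_measure_unique => //= _ [[a b] _ <-] /=.
  change (mu `]a, b]%classic = `|k|%:E * mu (f @^-1` `]a, b]%classic))%E.
  have [kp|kn|/eqP] := ltgtP 0 k; last by rewrite eq_sym (negPf k0).
  - have -> : f @^-1` `]a, b] = `](a - h) / k, (b - h) / k]%classic.
      apply/seteqP; split => z /=; rewrite !in_itv /= /f ltr_pdivrMr// ler_pdivlMr// (mulrC z) ltrBlDr lerBrDr //.
    rewrite !lebesgue_measure_itv /= !lte_fin ltr_pM2r ?invr_gt0// ltrD2r.
    case: ifPn => _; last by rewrite mule0.
    rewrite gtr0_norm // -!EFinD -EFinM; congr (_%:E); field; exact: k0.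
  - have -> : f @^-1` `]a, b] = `[(b - h) / k, (a - h) / k[%classic.
      apply/seteqP; split => z /=; rewrite !in_itv /= /f ltr_ndivlMr// ler_ndivrMr// (mulrC z) ltrBlDr lerBrDr andbC //.
    rewrite !lebesgue_measure_itv /= !lte_fin ltr_nM2r ?invr_lt0// ltrD2r.
    case: ifPn => _; last by rewrite mule0.
    rewrite ltr0_norm // -!EFinD -EFinM; congr (_%:E); field; exact: k0.
rewrite (E mf) /mscale /pushforward /= muleA -EFinM mulVf ?gt_eqF// mul1e //.
Qed.

(** Sections over the first coordinate reduce this to dimension one. With [h] affine it is an
    elementary row operation, the building block for general affine maps. *)
Lemma prod_affine d (T : measurableType d) (m : {measure set T -> \bar R})
    (k : R) (h : T -> R) (S : set (T * mR)) : k != 0 -> measurable S ->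
  (m \x mu)%E ((fun p : T * mR => (p.1, (k * p.2 + h p.1 : mR))) @^-1` S)
  = ((`|k|^-1)%:E * (m \x mu) S)%E.
Proof.
move=> k0 mS; rewrite /product_measure1 -ge0_integralZl//; last first.
  exact: measurable_fun_xsection.
apply: eq_integral => x _ /=.
rewrite -(@leb_affine k (h x))//; last exact: measurable_xsection.
Qed.

Lemma prod_swap d1 d2 (T1 : measurableType d1) (T2 : measurableType d2)
    (m1 : {sigma_finite_measure set T1 -> \bar R})
    (m2 : {sigma_finite_measure set T2 -> \bar R}) (S : set (T2 * T1)) :
  measurable S ->
  (m1 \x m2)%E ((fun p : T1 * T2 => (p.2, p.1)) @^-1` S) = (m2 \x m1)%E S.
Proof.
move=> mS.
have mS' : measurable ((fun p : T1 * T2 => (p.2, p.1)) @^-1` S).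
  rewrite -[X in measurable X]setTI.
  by have : measurable_fun [set: T1 * T2] (fun p => (p.2, p.1));
    [exact: measurable_fun_pair|exact].
rewrite (product_measure_unique (m' := (m1 \x^ m2)%E))//.
  by move=> A B mA mB; exact: product_measure2E.
Qed.

Lemma prod_assoc d1 d2 d3 (T1 : measurableType d1) (T2 : measurableType d2)
    (T3 : measurableType d3)
    (m1 : {sigma_finite_measure set T1 -> \bar R})
    (m2 : {sigma_finite_measure set T2 -> \bar R})
    (m3 : {sigma_finite_measure set T3 -> \bar R}) (S : set ((T1 * T2) * T3)) :
  measurable S ->
  ((m1 \x m2) \x m3)%E S
  = (\int[m1]_x (m2 \x m3) [set q : T2 * T3 | S ((x, q.1), q.2)])%E.
Proof.
move=> mS; rewrite {1}/product_measure1.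
have := fubini_tonelli1 (m1 := m1) (m2 := m2) (m3 \o xsection S).
rewrite /fubini_F => ->.
- apply: eq_integral => x _; rewrite /product_measure1; apply: eq_integral => y _ /=.
  by congr (m3 _); apply/seteqP; split => z; rewrite /xsection /= !inE.
- exact: measurable_fun_xsection.
- by move=> x /=.
Qed.

(** Swaps of adjacent coordinates generate all permutations of the three; in the nested product this
    one amounts to exchanging the two outer integrals by Tonelli. *)
Lemma prod_swap12 d (T : measurableType d) (m : {sigma_finite_measure set T -> \bar R})
    (S : set ((T * T) * T)) : measurable S ->
  ((m \x m) \x m)%E ((fun q : (T * T) * T => ((q.1.2, q.1.1), q.2)) @^-1` S)
  = ((m \x m) \x m)%E S.
Proof.
move=> mS.
have m1 : measurable_fun setT (fun q : (T * T) * T => q.1) by exact: measurable_fst.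
have mf : measurable_fun setT (fun q : (T * T) * T => ((q.1.2, q.1.1), q.2)).
  apply: measurable_fun_pair => //; apply: measurable_fun_pair.
    exact: measurableT_comp m1.
  exact: measurableT_comp m1.
have mfS : measurable ((fun q : (T * T) * T => ((q.1.2, q.1.1), q.2)) @^-1` S).
  by rewrite -[X in measurable X]setTI; exact: mf.
have /(fubini_tonelli (m1 := m) (m2 := m)) : measurable_fun setT (m \o xsection S).
  exact: measurable_fun_xsection.
move=> /(_ (fun _ => measure_ge0 _ _)) FT.
transitivity (\int[m]_x (m \x m) [set q : T * T | S ((q.1, x), q.2)])%E.
  exact: (@prod_assoc _ _ _ _ _ _ m m m).
have E x y : (m \o xsection S) (x, y) = m (xsection [set q : T * T | S ((x, q.1), q.2)] y).
  by rewrite /=; congr (m _); apply/seteqP; split => z; rewrite /xsection /= !inE.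
have E' x y : (m \o xsection S) (x, y) = m (xsection [set q : T * T | S ((q.1, y), q.2)] x).
  by rewrite /=; congr (m _); apply/seteqP; split => z; rewrite /xsection /= !inE.
transitivity (\int[m]_y \int[m]_x (m \o xsection S) (x, y))%E.
  by apply: eq_integral => y _; apply: eq_integral => x _; rewrite E'.
rewrite -FT (@prod_assoc _ _ _ _ _ _ m m m S mS).
by apply: eq_integral => y _; apply: eq_integral => x _; rewrite E.
Qed.

Lemma prod_swap23 d (T : measurableType d) (m : {sigma_finite_measure set T -> \bar R})
    (S : set ((T * T) * T)) : measurable S ->
  ((m \x m) \x m)%E ((fun q : (T * T) * T => ((q.1.1, q.2), q.1.2)) @^-1` S)
  = ((m \x m) \x m)%E S.
Proof.
move=> mS.
have m1 : measurable_fun setT (fun q : (T * T) * T => q.1) by exact: measurable_fst.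
have mf : measurable_fun setT (fun q : (T * T) * T => ((q.1.1, q.2), q.1.2)).
  apply: measurable_fun_pair; first apply: measurable_fun_pair => //.
    exact: measurableT_comp m1.
  exact: measurableT_comp m1.
have mfS : measurable ((fun q : (T * T) * T => ((q.1.1, q.2), q.1.2)) @^-1` S).
  by rewrite -[X in measurable X]setTI; exact: mf.
transitivity (\int[m]_x (m \x m) [set q : T * T | S ((x, q.2), q.1)])%E.
  exact: (@prod_assoc _ _ _ _ _ _ m m m).
transitivity (\int[m]_x (m \x m) [set q : T * T | S ((x, q.1), q.2)])%E; last first.
  by apply/esym; exact: (@prod_assoc _ _ _ _ _ _ m m m).
apply: eq_integral => x _ /=.
rewrite -(@prod_swap _ _ _ _ m m) //.
have mg : measurable_fun setT (fun q : T * T => ((x, q.2), q.1)).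
  by apply: measurable_fun_pair => //; apply: measurable_fun_pair.
by rewrite -[X in measurable X]setTI; exact: mg.
Qed.

Local Notation T3 := ((mR * mR) * mR)%type.

(** Bundling measurability with the factor makes the notion closed under composition, so that
    determinants can be built up from elementary maps. *)
Definition scales (f : T3 -> T3) (c : R) :=
  measurable_fun setT f /\
  forall S : set T3, measurable S -> vol3 (f @^-1` S) = (c%:E * vol3 S)%E.

Lemma scales_comp f g c d : scales f c -> scales g d -> scales (g \o f) (c * d).
Proof.
move=> [mf Hf] [mg Hg]; split; first exact: measurableT_comp.
move=> S mS; have mgS : measurable (g @^-1` S).
  by rewrite -[X in measurable X]setTI; exact: mg.
by rewrite EFinM -muleA -Hg // -Hf.
Qed.

Lemma eq_scales f g c : scales f c -> f =1 g -> scales g c.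
Proof. by move=> Hf /funext <-. Qed.

Definition lin3 (n q : (R * R) * R) : R :=
  n.1.1 * q.1.1 + n.1.2 * q.1.2 + n.2 * q.2.

Lemma measurable_lin3 (n : (R * R) * R) (k : R) :
  measurable_fun setT (fun q : T3 => (lin3 n q + k : mR)).
Proof.
have m1 : measurable_fun setT (fun q : T3 => q.1 : mR * mR) by exact: measurable_fst.
apply: measurable_funD => //; apply: measurable_funD; [apply: measurable_funD|];
  apply: measurable_funM => //.
- exact: measurableT_comp m1.
- exact: measurableT_comp m1.
Qed.

Lemma scales_swap12 : scales (fun q : T3 => ((q.1.2, q.1.1), q.2)) 1.
Proof.
have ms : measurable_fun setT (fun p : mR * mR => (p.2, p.1)) by exact: measurable_fun_pair.
split; first by apply: measurable_fun_pair => //; exact: measurableT_comp ms measurable_fst.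
move=> S mS; rewrite mul1e /vol3 /leb.
exact: (@prod_swap12 _ _ mu).
Qed.

Lemma scales_swap23 : scales (fun q : T3 => ((q.1.1, q.2), q.1.2)) 1.
Proof.
have m1 : measurable_fun setT (fun q : T3 => q.1 : mR * mR) by exact: measurable_fst.
have mf : measurable_fun setT (fun q : T3 => ((q.1.1, q.2), q.1.2) : T3).
  apply: measurable_fun_pair; first apply: measurable_fun_pair => //.
    exact: measurableT_comp m1.
  exact: measurableT_comp m1.
split=> // S mS; rewrite mul1e /vol3 /leb.
exact: (@prod_swap23 _ _ mu).
Qed.

Lemma scales_swap13 : scales (fun q : T3 => ((q.2, q.1.2), q.1.1)) 1.
Proof.
have := scales_comp (scales_comp scales_swap12 scales_swap23) scales_swap12.
by rewrite !mul1r; move/eq_scales; apply => -[[a b] c].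
Qed.

Lemma scales_row3 (n : (R * R) * R) k : n.2 != 0 ->
  scales (fun q => (q.1, lin3 n q + k)) `|n.2|^-1.
Proof.
move=> n0; split.
  by apply: measurable_fun_pair => //; exact: measurable_lin3.
move=> S mS; rewrite /vol3 /leb.
pose h (p : mR * mR) : R := n.1.1 * p.1 + n.1.2 * p.2 + k.
have -> : (fun q : T3 => (q.1, lin3 n q + k)) @^-1` S
    = (fun p : T3 => (p.1, (n.2 * p.2 + h p.1 : mR))) @^-1` S.
  apply/seteqP; split=> -[[a b] c]; rewrite /= /lin3 /h /=;
  by rewrite (_ : n.1.1 * a + n.1.2 * b + n.2 * c + k =
      n.2 * c + (n.1.1 * a + n.1.2 * b + k))//; ring.
exact: (@prod_affine _ (mR * mR)%type (mu \x mu)%E n.2 h S).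
Qed.

Lemma scales_row2 (n : (R * R) * R) k : n.1.2 != 0 ->
  scales (fun q => ((q.1.1, lin3 n q + k), q.2)) `|n.1.2|^-1.
Proof.
move=> n0.
have := scales_comp (scales_comp scales_swap23
  (@scales_row3 ((n.1.1, n.2), n.1.2) k n0)) scales_swap23.
rewrite mul1r mulr1; move/eq_scales; apply => -[[a b] c] /=.
by congr ((_, _), _); rewrite /lin3 /=; ring.
Qed.

Lemma scales_row1 (n : (R * R) * R) k : n.1.1 != 0 ->
  scales (fun q => ((lin3 n q + k, q.1.2), q.2)) `|n.1.1|^-1.
Proof.
move=> n0.
have := scales_comp (scales_comp scales_swap12
  (@scales_row2 ((n.1.2, n.1.1), n.2) k n0)) scales_swap12.
rewrite mul1r mulr1; move/eq_scales; apply => -[[a b] c] /=.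
by congr ((_, _), _); rewrite /lin3 /=; ring.
Qed.

Definition det3 (a b c : (R * R) * R) : R :=
  a.1.1 * (b.1.2 * c.2 - b.2 * c.1.2) - a.1.2 * (b.1.1 * c.2 - b.2 * c.1.1)
  + a.2 * (b.1.1 * c.1.2 - b.1.2 * c.1.1).

(** Gaussian elimination: once the second coordinate has become the second form, the first form
    rewritten in the new coordinates has leading coefficient [a - b * d / e], and the pivots
    multiply to the determinant. A zero [e] is removed by a swap of coordinates. *)
Lemma scales_rows12 (n1 n2 : (R * R) * R) k1 k2 :
  n1.1.1 * n2.1.2 - n1.1.2 * n2.1.1 != 0 ->
  scales (fun q => ((lin3 n1 q + k1, lin3 n2 q + k2), q.2))
    `|n1.1.1 * n2.1.2 - n1.1.2 * n2.1.1|^-1.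
Proof.
have base (m1 m2 : (R * R) * R) : m2.1.2 != 0 ->
    m1.1.1 * m2.1.2 - m1.1.2 * m2.1.1 != 0 ->
    scales (fun q => ((lin3 m1 q + k1, lin3 m2 q + k2), q.2))
      `|m1.1.1 * m2.1.2 - m1.1.2 * m2.1.1|^-1.
  move: m1 m2 => [[a b] c] [[d e] f] /= e0 D.
  have D' : a - b * d / e != 0.
    have <- : (a * e - b * d) / e = a - b * d / e by field; exact: e0.
    by rewrite mulf_neq0 // invr_eq0.
  have := scales_comp (@scales_row2 ((d, e), f) k2 e0)
    (@scales_row1 ((a - b * d / e, b / e), c - b * f / e) (k1 - b * k2 / e) D').
  rewrite /= -invfM -normrM (_ : e * (a - b * d / e) = a * e - b * d); last by field; exact: e0.
  move/eq_scales; apply => -[[x y] z] /=.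
  by congr ((_, _), _); rewrite /lin3 /=; field.
move: n1 n2 => [[a b] c] [[d e] f] /= D.
have [e0|e0] := eqVneq e 0; last exact: (base ((a, b), c) ((d, e), f)).
have d0 : d != 0 by apply: contraNneq D => d0; rewrite d0 e0; apply/eqP; ring.
have D' : b * d - a * e != 0 by rewrite -oppr_eq0 opprB.
have := scales_comp scales_swap12 (base ((b, a), c) ((e, d), f) d0 D').
rewrite mul1r /= distrC; move/eq_scales; apply => -[[x y] z] /=.
by congr ((_, _), _); rewrite /lin3 /=; ring.
Qed.

Lemma scales_rows (n1 n2 n3 : (R * R) * R) k1 k2 k3 : det3 n1 n2 n3 != 0 ->
  scales (fun q => ((lin3 n1 q + k1, lin3 n2 q + k2), lin3 n3 q + k3))
    `|det3 n1 n2 n3|^-1.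
Proof.
have base (m1 m2 m3 : (R * R) * R) : m3.2 != 0 -> det3 m1 m2 m3 != 0 ->
    scales (fun q => ((lin3 m1 q + k1, lin3 m2 q + k2), lin3 m3 q + k3))
      `|det3 m1 m2 m3|^-1.
  move: m1 m2 m3 => [[a b] c] [[d e] f] [[g h] i]; rewrite /det3 /= => i0 D.
  pose r1 := ((a - c * g / i, b - c * h / i), c / i).
  pose r2 := ((d - f * g / i, e - f * h / i), f / i).
  have E : r1.1.1 * r2.1.2 - r1.1.2 * r2.1.1
      = (a * (e * i - f * h) - b * (d * i - f * g) + c * (d * h - e * g)) / i.
    by rewrite /r1 /r2 /=; field.
  have D' : r1.1.1 * r2.1.2 - r1.1.2 * r2.1.1 != 0.
    by rewrite E mulf_neq0 // invr_eq0.
  have := scales_comp (@scales_row3 ((g, h), i) k3 i0)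
    (scales_rows12 (k1 - c * k3 / i) (k2 - f * k3 / i) D').
  rewrite -invfM -normrM E /= [i * _]mulrC divfK//.
  move/eq_scales; apply => -[[x y] z] /=.
  by congr ((_, _), _); rewrite /lin3 /=; field.
move: n1 n2 n3 => [[a b] c] [[d e] f] [[g h] i] D.
have [i0|i0] := eqVneq i 0; last exact: (base ((a, b), c) ((d, e), f) ((g, h), i)).
have [h0|h0] := eqVneq h 0.
  have g0 : g != 0.
    by apply: contraNneq D => g0; rewrite /det3 /= g0 h0 i0; apply/eqP; ring.
  have E : det3 ((c, b), a) ((f, e), d) ((i, h), g)
      = - det3 ((a, b), c) ((d, e), f) ((g, h), i) by rewrite /det3 /=; ring.
  have := scales_comp scales_swap13 (base ((c, b), a) ((f, e), d) ((i, h), g) g0 _).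
  rewrite E oppr_eq0 normrN mul1r => /(_ D); move/eq_scales; apply => -[[x y] z] /=.
  by congr ((_, _), _); rewrite /lin3 /=; ring.
have E : det3 ((a, c), b) ((d, f), e) ((g, i), h)
    = - det3 ((a, b), c) ((d, e), f) ((g, h), i) by rewrite /det3 /=; ring.
have := scales_comp scales_swap23 (base ((a, c), b) ((d, f), e) ((g, i), h) h0 _).
rewrite E oppr_eq0 normrN mul1r => /(_ D); move/eq_scales; apply => -[[x y] z] /=.
by congr ((_, _), _); rewrite /lin3 /=; ring.
Qed.

Lemma vol3_box (A B C : set mR) : measurable A -> measurable B -> measurable C ->
  vol3 ((A `*` B) `*` C) = (leb A * leb B * leb C)%E.
Proof.
move=> mA mB mC; rewrite /vol3 /leb product_measure1E//; last exact: measurableX.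
by congr (_ * _)%E; exact: product_measure1E.
Qed.

Definition cube : set T3 := ([set` `[0, 1]] `*` [set` `[0, 1]]) `*` [set` `[0, 1]].

(** Replacing a coordinate whose coefficient is nonzero by the form itself carries the strip into a
    box with unit base and height [b - a]; [C] is the inverse of the absolute value of that
    coefficient. This is what makes volumes Lipschitz when a face is translated. *)
Lemma strip_vol3 (n : (R * R) * R) : n != 0 -> exists2 C : R, 0 <= C &
  forall a b : R, a <= b ->
  (vol3 (cube `&` [set q | a <= lin3 n q <= b]%R) <= (C * (b - a))%:E)%E.
Proof.
have mc : measurable ([set` `[0, 1]] : set mR) by exact: measurable_itv.
have mab a b : measurable ([set` `[a, b]] : set mR) by exact: measurable_itv.
have l1 : leb ([set` `[0, 1]] : set mR) = 1%:E.
  by rewrite /leb lebesgue_measure_itv /= lte_fin ltr01 sube0.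
have lab a b : a <= b -> leb ([set` `[a, b]] : set mR) = (b - a)%:E.
  rewrite le_eqVlt => /predU1P[->|ab].
    by rewrite /leb lebesgue_measure_itv /= ltxx subrr.
  by rewrite /leb lebesgue_measure_itv /= lte_fin ab.
have main f c (X : R -> R -> set T3) : scales f c -> 0 <= c ->
    (forall a b, measurable (X a b)) ->
    (forall a b, a <= b -> vol3 (X a b) = (b - a)%:E) ->
    (forall a b, cube `&` [set q | a <= lin3 n q <= b]%R `<=` f @^-1` (X a b)) ->
    exists2 C : R, 0 <= C & forall a b : R, a <= b ->
    (vol3 (cube `&` [set q | a <= lin3 n q <= b]%R) <= (C * (b - a))%:E)%E.
  move=> [mf Hf] c0 mX vX sX; exists c => // a b ab.
  rewrite EFinM -vX // -Hf //.
  apply: (@le_measure _ _ _ ((mu \x mu) \x mu)%E); rewrite ?inE //.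
  - apply: measurableI; first by apply: measurableX => //; exact: measurableX.
    have ml := measurable_lin3 n 0.
    rewrite (_ : [set q | _] = (fun q : T3 => lin3 n q + 0) @^-1` [set` `[a, b]]).
      by rewrite -[X in measurable X]setTI; exact: ml.
    by apply/seteqP; split=> q /=; rewrite in_itv /= addr0.
  - by rewrite -[X in measurable X]setTI; exact: mf.
have [n3|n3] := eqVneq n.2 0; last first.
  move=> _; apply: (main _ _ (fun a b => ([set` `[0, 1]] `*` [set` `[0, 1]]) `*` [set` `[a, b]])
    (scales_row3 0 n3)) => //.
  - by move=> a b; do ?apply: measurableX.
  - by move=> a b ab; rewrite vol3_box // l1 lab // !mul1e.
  - by move=> a b q [[[q1 q2] q3] /= H]; split=> //=; rewrite in_itv /= addr0.
have [n2|n2] := eqVneq n.1.2 0; last first.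
  move=> _; apply: (main _ _ (fun a b => ([set` `[0, 1]] `*` [set` `[a, b]]) `*` [set` `[0, 1]])
    (scales_row2 0 n2)) => //.
  - by move=> a b; do ?apply: measurableX.
  - by move=> a b ab; rewrite vol3_box // l1 lab // mul1e mule1.
  - by move=> a b q [[[q1 q2] q3] /= H]; split=> //=; split=> //=; rewrite in_itv /= addr0.
have [n1|n1] := eqVneq n.1.1 0; last first.
  move=> _; apply: (main _ _ (fun a b => ([set` `[a, b]] `*` [set` `[0, 1]]) `*` [set` `[0, 1]])
    (scales_row1 0 n1)) => //.
  - by move=> a b; do ?apply: measurableX.
  - by move=> a b ab; rewrite vol3_box // l1 lab // !mule1.
  - by move=> a b q [[[q1 q2] q3] /= H]; split=> //=; split=> //=; rewrite in_itv /= addr0.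
move: n n1 n2 n3 {main} => [[a b] c] /= -> -> ->; by rewrite eqxx.
Qed.

Lemma plane_vol3 (n : (R * R) * R) (k : R) : n != 0 ->
  vol3 [set q | lin3 n q = k] = 0%E.
Proof.
have l0 : leb ([set k] : set mR) = 0%E by exact: lebesgue_measure_set1.
have mk : measurable ([set k] : set mR) by [].
have main f c (X : set T3) : scales f c -> measurable X -> vol3 X = 0%E ->
    [set q | lin3 n q = k] = f @^-1` X -> vol3 [set q | lin3 n q = k] = 0%E.
  by move=> [_ Hf] mX vX ->; rewrite Hf// vX mule0.
have [n3|n3] := eqVneq n.2 0; last first.
  move=> _; apply: (main _ _ ((setT `*` setT) `*` [set k]) (scales_row3 0 n3)).
  - by do ?apply: measurableX.
  - by rewrite vol3_box // l0 mule0.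
  - by apply/seteqP; split=> q /=; rewrite addr0; [|case].
have [n2|n2] := eqVneq n.1.2 0; last first.
  move=> _; apply: (main _ _ ((setT `*` [set k]) `*` setT) (scales_row2 0 n2)).
  - by do ?apply: measurableX.
  - by rewrite vol3_box // l0 mule0 mul0e.
  - by apply/seteqP; split=> q /=; rewrite addr0; [|case; case].
have [n1|n1] := eqVneq n.1.1 0; last first.
  move=> _; apply: (main _ _ (([set k] `*` setT) `*` setT) (scales_row1 0 n1)).
  - by do ?apply: measurableX.
  - by rewrite vol3_box // l0 !mul0e.
  - by apply/seteqP; split=> q /=; rewrite addr0; [|case; case].
move: n n1 n2 n3 {main} => [[a b] c] /= -> -> ->; by rewrite eqxx.
Qed.

End AffineMeasure.

(** * Volumes of simplices, barycentric triangles, fibers and affine images *)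

Section Volumes.
Context {R : realType}.
Local Notation mR := (measurableTypeR R).
Local Notation mu := (@lebesgue_measure R).
Local Notation T3 := ((mR * mR) * mR)%type.

Lemma sigma_finite_prod d1 d2 (T1 : measurableType d1) (T2 : measurableType d2)
    (m1 : {sigma_finite_measure set T1 -> \bar R})
    (m2 : {sigma_finite_measure set T2 -> \bar R}) : sigma_finite setT (m1 \x m2)%E.
Proof.
have /sigma_finiteP[F [TF ndF Foo]] := sigma_finiteT m1.
have /sigma_finiteP[G [TG ndG Goo]] := sigma_finiteT m2.
exists (fun n => F n `*` G n).
  rewrite -setXTT TF TG predeqE => -[x y]; split=> [[/= [n _ Fnx] [k _ Gky]]|[n _ [/= ? ?]]].
    exists (maxn n k) => //; split=> /=.
      by move: x Fnx; exact/subsetPset/ndF/leq_maxl.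
    by move: y Gky; exact/subsetPset/ndG/leq_maxr.
  by split; exists n.
move=> k; have [? ?] := Foo k; have [? ?] := Goo k.
by split; [exact: measurableX|rewrite product_measure1E// lte_mul_pinfty// ge0_fin_numE].
Qed.

(** A named copy of the product measure can carry the sigma-finite structure that Tonelli on R^2 x
    R^3 requires. *)
Definition leb2 : set (mR * mR) -> \bar R := (mu \x mu)%E.
HB.instance Definition _ := Measure.on leb2.
HB.instance Definition _ := Measure_isSigmaFinite.Build _ _ _ leb2 (sigma_finite_prod mu mu).
Definition leb3 : set T3 -> \bar R := (leb2 \x mu)%E.
HB.instance Definition _ := Measure.on leb3.
HB.instance Definition _ := Measure_isSigmaFinite.Build _ _ _ leb3 (sigma_finite_prod leb2 mu).

Lemma leb3E : leb3 = @vol3 R. Proof. by []. Qed.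

(** For positive [k], the volume of the standard [k]-simplex of size [h]; the truncation covers the
    empty simplex. *)
Definition spow (k : nat) (h : R) : R := Num.max h 0 ^+ k / k`!%:R.

(** The slice of a simplex at height [a] is a simplex of size [h - a], so each integration raises
    the dimension by one. The exponent starts at 1 because [spow 0] is 1 even at negative
    arguments. *)
Lemma integral_spow k h :
  (\int[mu]_a ((0 <= a)%R%:R * spow k.+1 (h - a))%:E = (spow k.+2 h)%:E)%E.
Proof.
have [h0|h0] := leP h 0.
  rewrite /spow (max_idPr h0) expr0n /= mul0r integral0_eq // => a _.
  have [a0|a0] := pselect (0 <= a); last by rewrite (negPf (introN idP a0)) mul0r.
  by rewrite (max_idPr _) ?expr0n ?mul0r ?mulr0// subr_le0 (le_trans h0).
(* On the support the integrand is the polynomial [(h - a)^m / m!] in [a], with antiderivative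
   [- p m.+1]. *)
pose p (m : nat) : {poly R} := (m`!%:R^-1)%:P * (h%:P - 'X) ^+ m.
have pE m a : (p m).[a] = (h - a) ^+ m / m`!%:R.
  by rewrite /p hornerM horner_exp !hornerE mulrC.
have dp m : (- p m.+1)^`()%R = p m.
  rewrite /p derivN derivM derivC mul0r add0r deriv_exp derivB derivC derivX sub0r mulN1r.
  rewrite mulNrn mulrN opprK /= mulrnAr -mulrnAl -polyCMn; congr (_%:P * _).
  by rewrite -[LHS]mulr_natr factS natrM invfM mulrAC mulVf ?mul1r// pnatr_eq0.
transitivity (\int[mu]_(a in `[0%R, h]) ((p k.+1).[a])%:E)%E.
  rewrite [RHS]integral_mkcond; apply: eq_integral => a _; rewrite /patch.
  have [|nah] := pselect ((`[0, h]%classic : set R) a).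
    move=> ah; rewrite mem_set //; move: ah; rewrite /= in_itv /= => /andP[a0 ah].
    by rewrite a0 mul1r /spow pE (max_idPl _)// subr_ge0.
  rewrite memNset //; move: nah; rewrite /= in_itv /=; case: (leP 0 a) => a0 /= ah; last by rewrite mul0r.
  have {}ah : h <= a by rewrite ltW// ltNge; exact/negP.
  by rewrite /spow (max_idPr _) ?expr0n ?mul0r ?mulr0// subr_le0.
have cp (q : {poly R}) x : q.[y] @[y --> x] --> q.[x] by exact: continuous_horner.
rewrite (@continuous_FTC2 R (horner (p k.+1)) (horner (- p k.+2)) 0 h) //.
- by rewrite -EFinB !hornerN !pE subrr subr0 expr0n /= mul0r oppr0 sub0r opprK /spow (max_idPl (ltW h0)).
- by apply: continuous_subspaceT => x; exact: continuous_horner.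
- split; first by move=> x _; exact: derivable_horner.
    by apply: cvg_at_right_filter; exact: cp.
  by apply: cvg_at_left_filter; exact: cp.
- by move=> x _; rewrite -derivE dp.
Qed.

(** Obtained from the spatial case by taking the product with the unit interval, whose length 1 does
    not change the measure. *)
Lemma area_affine (a b c d k l : R) (S : set (mR * mR)) : a * d - b * c != 0 ->
  measurable S ->
  leb2 ((fun x : mR * mR => ((a * x.1 + b * x.2 + k : mR), (c * x.1 + d * x.2 + l : mR))) @^-1` S)
  = ((`|a * d - b * c|^-1)%:E * leb2 S)%E.
Proof.
move=> D mS.
have [mf Hf] := scales_rows12 (n1 := ((a, b), 0)) (n2 := ((c, d), 0)) k l D.
have mI : measurable ([set` `[0, 1]] : set mR) by exact: measurable_itv.
have I1 : mu ([set` `[0, 1]] : set mR) = 1%:E.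
  by rewrite lebesgue_measure_itv /= lte_fin ltr01 sube0.
have P (A : set (mR * mR)) : measurable A -> vol3 (A `*` [set` `[0, 1]]) = leb2 A.
  move=> mA; rewrite -leb3E /leb3 product_measure1E//.
  by rewrite -[RHS]mule1; congr (_ * _)%E; exact: I1.
have := Hf _ (measurableX mS mI); rewrite P // => <-.
set f := (X in leb2 (X @^-1` _)).
have mff : measurable_fun setT f.
  by apply: measurable_fun_pair; do ![apply: measurable_funD|apply: measurable_funM] => //.
rewrite -P; last by rewrite -[X in measurable X]setTI; exact: mff.
congr (vol3 _); apply/seteqP; split=> -[[x y] z]; rewrite /= /lin3 /f /= !mul0r !addr0.
  by [].
by [].
Qed.

Lemma area_simplex h : leb2 [set x | [/\ 0 <= x.1, 0 <= x.2 & x.1 + x.2 <= h]]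
  = (spow 2 h)%:E.
Proof.
rewrite -integral_spow; apply: eq_integral => a _ /=.
have [a0|a0] := pselect (0 <= a); last first.
  rewrite (negPf (introN idP a0)) mul0r (_ : xsection _ _ = set0) ?measure0//.
  by apply/seteqP; split=> // z; rewrite /xsection /= inE /= => -[].
rewrite a0 mul1r (_ : xsection _ _ = [set` `[0, h - a]]).
  rewrite lebesgue_measure_itv /= lte_fin /spow expr1 divr1.
  by case: ltP => _; rewrite ?sube0.
apply/seteqP; split=> z; rewrite /xsection /= inE /= in_itv /=.
  by move=> [_ -> /=]; rewrite -lerBrDl.
by move=> /andP[z0 zh]; split=> //; rewrite -lerBrDl.
Qed.

Lemma measurable_half (n : (R * R) * R) (k : R) :
  measurable ([set q | 0 <= lin3 n q + k] : set T3).
Proof.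
have ml := measurable_lin3 n k.
rewrite (_ : [set q | _] = (fun q : T3 => lin3 n q + k) @^-1` [set` `[0, +oo[]).
  by rewrite -[X in measurable X]setTI; exact: ml.
by apply/seteqP; split=> q /=; rewrite in_itv /= andbT.
Qed.

Lemma vol3_simplex h :
  vol3 [set q | [/\ 0 <= q.1.1, 0 <= q.1.2, 0 <= q.2 & q.1.1 + q.1.2 + q.2 <= h]]
  = (spow 3 h)%:E.
Proof.
rewrite -integral_spow -leb3E /leb3.
rewrite (@prod_assoc _ _ _ _ _ _ _ mu mu mu); last first.
  rewrite (_ : [set q | _] = [set q | 0 <= lin3 ((1, 0), 0) q + 0] `&`
    [set q | 0 <= lin3 ((0, 1), 0) q + 0] `&` [set q | 0 <= lin3 ((0, 0), 1) q + 0]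
    `&` [set q | 0 <= lin3 ((-1, -1), -1) q + h]).
    by do 3 (apply: measurableI; last exact: measurable_half); exact: measurable_half.
  apply/seteqP; split=> -[[x y] z]; rewrite /lin3 /=.
    by move=> [x0 y0 z0 H]; do 3 (split; [|lra]); lra.
  by move=> [[[x0 y0] z0] H]; split; lra.
apply: eq_integral => a _ /=.
have [a0|a0] := pselect (0 <= a); last first.
  rewrite (negPf (introN idP a0)) mul0r (_ : [set _ | _] = set0) ?measure0//.
  by apply/seteqP; split=> // z /= [].
rewrite a0 mul1r -area_simplex; congr (leb2 _).
apply/seteqP; split=> -[y z] /=.
  by move=> [_ y0 z0 H]; split=> //; lra.
by move=> [y0 z0 H]; split=> //; lra.
Qed.

(** Monotonicity for arbitrary sets: the product measure integrates the outer measures of sections,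
    and the integral of a nonnegative function is a supremum over the simple functions below it. It
    bounds sets given only as images. *)
Lemma le_prod_lebesgue d (T : measurableType d) (m : {measure set T -> \bar R})
    (A B : set (T * mR)) : A `<=` B -> ((m \x mu) A <= (m \x mu) B)%E.
Proof.
move=> AB; rewrite /product_measure1 !ge0_integralTE//.
apply: le_ereal_sup => _ [h hA <-]; exists h => // x; apply: le_trans (hA x) _.
by apply: le_mu_ext => y; rewrite /xsection /= !inE; exact: AB.
Qed.

(** Three uses of [integral_spow] turn [spow 2] into [spow 5 1], that is 1/5!. *)
Lemma integral_positive_cone (G : T3 -> \bar R) : measurable_fun setT G ->
  (forall q, G q = ((0 <= q.1.1)%R%:R * ((0 <= q.1.2)%R%:R * ((0 <= q.2)%R%:R
     * spow 2 (1 - q.1.1 - q.1.2 - q.2))))%:E) ->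
  (\int[leb3]_q G q = (120^-1)%:E)%E.
Proof.
move=> mG GE.
have n0 (b : bool) (y : R) : 0 <= y -> 0 <= b%:R * y.
  by move=> y0; rewrite mulr_ge0 // ler0n.
have s0 k y : 0 <= spow k y.
  by rewrite /spow divr_ge0 ?ler0n// exprn_ge0 // le_max lexx orbT.
have G0 q : (0 <= G q)%E by rewrite GE lee_fin; exact/n0/n0/n0/s0.
have intb (b : bool) (f : R -> R) : (\int[mu]_a (b%:R * f a)%:E = b%:R%:E * \int[mu]_a (f a)%:E)%E.
  case: b; first by rewrite mul1e; apply: eq_integral => a _; rewrite mul1r.
  by rewrite mul0e integral0_eq // => a _; rewrite mul0r.
have E1 p : (\int[mu]_c G (p, c) = ((0 <= p.1)%R%:R * ((0 <= p.2)%R%:R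
     * spow 3 (1 - p.1 - p.2)))%:E)%E.
  by under eq_integral do rewrite GE /=; rewrite !intb integral_spow -!EFinM.
transitivity (\int[leb2]_p \int[mu]_c G (p, c))%E.
  exact: (fubini_tonelli1 (m1 := leb2) (m2 := mu) G mG G0).
pose H p := (\int[mu]_c G (p, c))%E.
have mH : measurable_fun setT H.
  exact: (measurable_fun_fubini_tonelli_F (m2 := mu) G mG G0).
have H0 p : (0 <= H p)%E by rewrite /H E1 lee_fin; exact/n0/n0/s0.
transitivity (\int[mu]_a \int[mu]_b H (a, b))%E.
  exact: (fubini_tonelli1 (m1 := mu) (m2 := mu) H mH H0).
have E2 a : (\int[mu]_b H (a, b) = ((0 <= a)%R%:R * spow 4 (1 - a))%:E)%E.
  by under eq_integral do rewrite /H E1 /=; rewrite intb integral_spow -EFinM.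
under eq_integral do rewrite E2.
by rewrite integral_spow /spow (max_idPl ler01) expr1n div1r.
Qed.

Definition orient (a b c : R * R) : R :=
  (b.1 - a.1) * (c.2 - a.2) - (c.1 - a.1) * (b.2 - a.2).

(** Barycentric coordinates with respect to [r, s, t] by Cramer's rule, [orient] being twice the
    signed area. *)
Definition bc1 (r s t x : R * R) : R := orient x s t / orient r s t.
Definition bc2 (r s t x : R * R) : R := orient r x t / orient r s t.
Definition bc3 (r s t x : R * R) : R := orient r s x / orient r s t.

Lemma bc_sum r s t x : orient r s t != 0 -> bc1 r s t x + bc2 r s t x + bc3 r s t x = 1.
Proof. by rewrite /bc1 /bc2 /bc3 /orient => D; field. Qed.

Lemma measurable_bc d (T : measurableType d) (r s t : R * R) (f : T -> mR * mR) :
  measurable_fun setT f ->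
  [/\ measurable_fun setT (fun x => bc1 r s t (f x) : mR),
      measurable_fun setT (fun x => bc2 r s t (f x) : mR)
    & measurable_fun setT (fun x => bc3 r s t (f x) : mR)].
Proof.
move=> mf.
have m1 : measurable_fun setT (fun x => (f x).1 : mR) by exact: measurableT_comp mf.
have m2 : measurable_fun setT (fun x => (f x).2 : mR) by exact: measurableT_comp mf.
by split; apply: measurable_funM => //; apply: measurable_funB; apply: measurable_funM => //;
  do ?apply: measurable_funB => //.
Qed.

Lemma measurable_le d (T : measurableType d) (f g : T -> mR) :
  measurable_fun setT f -> measurable_fun setT g ->
  measurable [set x | (f x : R) <= g x].
Proof.
move=> mf mg.
rewrite (_ : [set x | _] = (fun x => (g x - f x : mR)) @^-1` [set` `[0, +oo[]).
  have m : measurable_fun setT (fun x => (g x - f x : mR)) by exact: measurable_funB.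
  by rewrite -[X in measurable X]setTI; exact: m.
by apply/seteqP; split=> q /=; rewrite in_itv /= andbT subr_ge0.
Qed.

(** The lower bounds cut out a triangle homothetic to [r s t] with ratio [1 - c1 - c2 - c3], empty
    if this is negative. The first two barycentric coordinates form an affine chart of determinant
    [1 / d], mapping it to a standard triangle. *)
Lemma area_bc (r s t : R * R) (c1 c2 c3 : R) : orient r s t != 0 ->
  leb2 [set x | [/\ c1 <= bc1 r s t x, c2 <= bc2 r s t x & c3 <= bc3 r s t x]]
  = (`|orient r s t| * spow 2 (1 - c1 - c2 - c3))%:E.
Proof.
move=> D; set d := orient r s t in D *.
pose S : set (mR * mR) := [set x | [/\ 0 <= x.1, 0 <= x.2 & x.1 + x.2 <= 1 - c1 - c2 - c3]].
have mS : measurable S.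
  rewrite (_ : S = [set x : mR * mR | (0 : R) <= x.1] `&` [set x : mR * mR | (0 : R) <= x.2]
    `&` [set x : mR * mR | (x.1 + x.2 : R) <= 1 - c1 - c2 - c3]).
    apply: measurableI; first apply: measurableI; apply: measurable_le => //.
    exact: measurable_funD.
  by apply/seteqP; split=> x; rewrite /S /=; [case|case; case].
pose a := (s.2 - t.2) / d; pose b := (t.1 - s.1) / d.
pose a' := (t.2 - r.2) / d; pose b' := (r.1 - t.1) / d.
have E : a * b' - b * a' = d^-1.
  by rewrite /a /b /a' /b'; move: D; rewrite /d /orient => D; field.
have E0 : a * b' - b * a' != 0 by rewrite E invr_eq0.
have := area_affine ((s.1 * t.2 - t.1 * s.2) / d - c1)
  ((t.1 * r.2 - r.1 * t.2) / d - c2) E0 mS.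
rewrite E normfV invrK area_simplex -EFinM => <-; congr (leb2 _).
have F1 (x : R * R) : a * x.1 + b * x.2 + ((s.1 * t.2 - t.1 * s.2) / d - c1) = bc1 r s t x - c1.
  by rewrite /a /b /bc1 -/d; move: D; rewrite /d /orient => D; field.
have F2 (x : R * R) : a' * x.1 + b' * x.2 + ((t.1 * r.2 - r.1 * t.2) / d - c2) = bc2 r s t x - c2.
  by rewrite /a' /b' /bc2 -/d; move: D; rewrite /d /orient => D; field.
apply/seteqP; split=> x; rewrite /S /= F1 F2 => -[h1 h2 h3];
  have := bc_sum x D; by split; lra.
Qed.

Definition nv (f : R * R -> R) (u v w : R * R) : (R * R) * R := ((f u, f v), f w).

(* The weights of the knots u, v, w in the representations of x as a convex combination
   of the six knots; those of r, s, t are then determined by x. *)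
Definition fiber (r s t u v w x : R * R) : set T3 :=
  [set q | [/\ 0 <= q.1.1, 0 <= q.1.2 & 0 <= q.2] /\
    [/\ lin3 (nv (bc1 r s t) u v w) q <= bc1 r s t x,
        lin3 (nv (bc2 r s t) u v w) q <= bc2 r s t x
      & lin3 (nv (bc3 r s t) u v w) q <= bc3 r s t x]].

Lemma measurable_fiber2 (r s t u v w : R * R) :
  measurable ([set p | fiber r s t u v w p.1 p.2] : set ((mR * mR) * T3)).
Proof.
have m1 : measurable_fun setT (fun p : (mR * mR) * T3 => p.1) by exact: measurable_fst.
have m2 : measurable_fun setT (fun p : (mR * mR) * T3 => p.2) by exact: measurable_snd.
have m21 : measurable_fun setT (fun p : (mR * mR) * T3 => p.2.1) by exact: measurableT_comp m2.
have ml n : measurable_fun setT (fun p : (mR * mR) * T3 => (lin3 n p.2 : mR)).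
  have := measurableT_comp (measurable_lin3 n 0) m2; congr measurable_fun.
  by apply/funext => p /=; rewrite addr0.
have [b1 b2 b3] := measurable_bc r s t m1.
rewrite (_ : [set p | _] =
    ([set p : (mR * mR) * T3 | (0 : R) <= p.2.1.1] `&`
     [set p : (mR * mR) * T3 | (0 : R) <= p.2.1.2] `&` [set p : (mR * mR) * T3 | (0 : R) <= p.2.2]) `&`
    ([set p | lin3 (nv (bc1 r s t) u v w) p.2 <= bc1 r s t p.1] `&`
     [set p | lin3 (nv (bc2 r s t) u v w) p.2 <= bc2 r s t p.1] `&`
     [set p | lin3 (nv (bc3 r s t) u v w) p.2 <= bc3 r s t p.1])).
  apply: measurableI; (apply: measurableI; first apply: measurableI); apply: measurable_le => //.
  - exact: measurableT_comp m21.
  - exact: measurableT_comp m21.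
  - exact: measurableT_comp m2.
apply/seteqP; split=> p; rewrite /fiber /=.
  by move=> [[? ? ?] [? ? ?]].
by move=> [[[? ?] ?] [[? ?] ?]].
Qed.

Lemma measurable_fiber (r s t u v w x : R * R) : measurable (fiber r s t u v w x).
Proof.
have := measurable_xsection x (measurable_fiber2 r s t u v w); congr measurable.
by apply/seteqP; split=> q; rewrite /xsection /= inE.
Qed.

(** Exchange the integrals: for fixed weights [q] the points [x] form a triangle homothetic to
    [r s t]. Since barycentric coordinates sum to 1 at every knot, its ratio is 1 minus the sum of
    the weights, whatever [u, v, w] are. *)
Lemma integral_fiber (r s t u v w : R * R) : orient r s t != 0 ->
  (\int[leb2]_x vol3 (fiber r s t u v w x) = (`|orient r s t| / 120)%:E)%E.
Proof.
move=> D; pose W : set ((mR * mR) * T3) := [set p | fiber r s t u v w p.1 p.2].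
have mW : measurable W by exact: measurable_fiber2.
transitivity ((leb2 \x leb3) W)%E.
  apply: eq_integral => x _; rewrite -leb3E /=; congr (leb3 _).
  by apply/seteqP; split=> q; rewrite /xsection /= inE.
pose W' : set (T3 * (mR * mR)) := [set p | fiber r s t u v w p.2 p.1].
have mW' : measurable W'.
  have m : measurable_fun setT (fun p : T3 * (mR * mR) => (p.2, p.1)) by exact: measurable_fun_pair.
  by rewrite -[X in measurable X]setTI; exact: (m measurableT _ mW).
transitivity ((leb3 \x leb2) W')%E; first exact: (prod_swap leb2 leb3 mW').
pose G q := ((`|orient r s t|^-1)%:E * leb2 (xsection W' q))%E.
have d0 : 0 < `|orient r s t| by rewrite normr_gt0.
transitivity (\int[leb3]_q (`|orient r s t|%:E * G q))%E.
  by apply: eq_integral => q _; rewrite /G muleA -EFinM divff ?gt_eqF// mul1e.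
have mG : measurable_fun setT G.
  by apply: measurable_funeM; exact: measurable_fun_xsection.
have GE q : G q = ((0 <= q.1.1)%R%:R * ((0 <= q.1.2)%R%:R * ((0 <= q.2)%R%:R
     * spow 2 (1 - q.1.1 - q.1.2 - q.2))))%:E.
  have [q0|q0] := pselect ([/\ 0 <= q.1.1, 0 <= q.1.2 & 0 <= q.2]).
    case: (q0) => -> -> ->; rewrite !mul1r /G.
    rewrite (_ : xsection _ _ = [set x | [/\ lin3 (nv (bc1 r s t) u v w) q <= bc1 r s t x,
        lin3 (nv (bc2 r s t) u v w) q <= bc2 r s t x
      & lin3 (nv (bc3 r s t) u v w) q <= bc3 r s t x]]).
      rewrite area_bc // -EFinM mulrA mulVf ?gt_eqF// mul1r; congr ((spow _ _)%:E).
      rewrite /lin3 /nv /=; have := bc_sum u D; have := bc_sum v D; have := bc_sum w D.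
      move=> w1 v1 u1.
      transitivity (1 - (q.1.1 * (bc1 r s t u + bc2 r s t u + bc3 r s t u)
        + q.1.2 * (bc1 r s t v + bc2 r s t v + bc3 r s t v)
        + q.2 * (bc1 r s t w + bc2 r s t w + bc3 r s t w))); first by ring.
      by rewrite u1 v1 w1; ring.
    by apply/seteqP; split=> x; rewrite /xsection /W' /fiber /= inE /=; [case|].
  rewrite /G (_ : xsection _ _ = set0) ?measure0 ?mule0.
    case: (boolP (0 <= q.1.1)) => [a|_]; last by rewrite mul0r.
    case: (boolP (0 <= q.1.2)) => [b|_]; last by rewrite mul0r mulr0.
    case: (boolP (0 <= q.2)) => [c|_]; last by rewrite mul0r !mulr0.
    by exfalso; apply: q0.
  by apply/seteqP; split=> x; rewrite /xsection /W' /fiber /= inE //= => -[].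
rewrite ge0_integralZl //.
- by rewrite integral_positive_cone.
- by move=> q _; rewrite /G mule_ge0 // lee_fin invr_ge0.
Qed.

Lemma scales_image (n1 n2 n3 : (R * R) * R) : det3 n1 n2 n3 != 0 ->
  exists2 c : R, 0 < c & forall k1 k2 k3 (S : set T3), measurable S ->
  vol3 [set y | exists2 q, S q &
    y = ((lin3 n1 q + k1, lin3 n2 q + k2), lin3 n3 q + k3)] = (c%:E * vol3 S)%E.
Proof.
move: n1 n2 n3 => [[a1 b1] c1] [[a2 b2] c2] [[a3 b3] c3] D.
pose d := det3 ((a1, b1), c1) ((a2, b2), c2) ((a3, b3), c3).
(* The rows of the inverse matrix, by cofactors: the image of [S] is its preimage under the inverse
   map. *)
pose m1 := (((b2 * c3 - c2 * b3) / d, (c1 * b3 - b1 * c3) / d), (b1 * c2 - c1 * b2) / d).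
pose m2 := (((c2 * a3 - a2 * c3) / d, (a1 * c3 - c1 * a3) / d), (c1 * a2 - a1 * c2) / d).
pose m3 := (((a2 * b3 - b2 * a3) / d, (b1 * a3 - a1 * b3) / d), (a1 * b2 - b1 * a2) / d).
have D' : det3 m1 m2 m3 != 0.
  have -> : det3 m1 m2 m3 = d^-1.
    by move: D; rewrite /m1 /m2 /m3 /d /det3 /= => D; field.
  by rewrite invr_eq0.
exists `|det3 m1 m2 m3|^-1; first by rewrite invr_gt0 normr_gt0.
move=> k1 k2 k3 S mS; pose k : (R * R) * R := ((k1, k2), k3).
have [_ H] := scales_rows (- lin3 m1 k) (- lin3 m2 k) (- lin3 m3 k) D'.
rewrite -(H S mS); congr (vol3 _); apply/seteqP; split=> [y [[[x1 x2] x3] Sq ->]|[[y1 y2] y3] /=].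
  rewrite /=; move: Sq; congr S.
  by move: D; rewrite /m1 /m2 /m3 /k /d /lin3 /det3 /= => D; congr ((_, _), _); field.
move=> Sy; eexists; first exact: Sy.
by move: D; rewrite /m1 /m2 /m3 /k /d /lin3 /det3 /= => D; congr ((_, _), _); field.
Qed.

Lemma vol3_image_degenerate (n1 n2 n3 : (R * R) * R) k1 k2 k3 (S : set T3) :
  det3 n1 n2 n3 = 0 ->
  vol3 [set y | exists2 q, S q &
    y = ((lin3 n1 q + k1, lin3 n2 q + k2), lin3 n3 q + k3)] = 0%E.
Proof.
move=> D.
have [m [m0 Hm]] : exists m : (R * R) * R, m != 0 /\
    [/\ m.1.1 * n1.1.1 + m.1.2 * n2.1.1 + m.2 * n3.1.1 = 0,
        m.1.1 * n1.1.2 + m.1.2 * n2.1.2 + m.2 * n3.1.2 = 0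
      & m.1.1 * n1.2 + m.1.2 * n2.2 + m.2 * n3.2 = 0].
  move: n1 n2 n3 D => [[a1 b1] c1] [[a2 b2] c2] [[a3 b3] c3]; rewrite /det3 /= => D.
  (* The rows of the adjugate annihilate a singular matrix from the left, so a nonzero one is normal
     to a plane containing the image. *)
  pose w1 : (R * R) * R := ((b2 * c3 - c2 * b3, c1 * b3 - b1 * c3), b1 * c2 - c1 * b2).
  pose w2 : (R * R) * R := ((c2 * a3 - a2 * c3, a1 * c3 - c1 * a3), c1 * a2 - a1 * c2).
  pose w3 : (R * R) * R := ((a2 * b3 - b2 * a3, b1 * a3 - a1 * b3), a1 * b2 - b1 * a2).
  have [e1|w10] := eqVneq w1 0; last by exists w1; split=> //; rewrite /w1 /=; split; first rewrite -D; ring.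
  have [e2|w20] := eqVneq w2 0; last by exists w2; split=> //; rewrite /w2 /=; split; [|rewrite -D|]; ring.
  have [e3|w30] := eqVneq w3 0; last by exists w3; split=> //; rewrite /w3 /=; split; [| |rewrite -D]; ring.
  case: e1 => _ _ e1; case: e2 => _ _ e2; case: e3 => _ _ e3.
  (* With vanishing adjugate the first two rows are proportional: a nonzero entry of the first row
     yields a relation between them, and otherwise the first row is zero. *)
  have [a10|a10] := eqVneq a1 0; last first.
    exists ((a2, - a1), 0); split.
      by apply: contraNneq a10 => -[_ /eqP]; rewrite oppr_eq0.
    by rewrite /=; split; lra.
  have [b10|b10] := eqVneq b1 0; last first.
    exists ((b2, - b1), 0); split.
      by apply: contraNneq b10 => -[_ /eqP]; rewrite oppr_eq0.
    by rewrite /=; split; lra.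
  have [c10|c10] := eqVneq c1 0; last first.
    exists ((c2, - c1), 0); split.
      by apply: contraNneq c10 => -[_ /eqP]; rewrite oppr_eq0.
    by rewrite /=; split; lra.
  exists ((1, 0), 0); split; last by rewrite a10 b10 c10 /=; split; ring.
  by apply/eqP => -[/eqP]; rewrite oner_eq0.
apply/le_anti/andP; split; last exact: (measure_ge0 leb3).
rewrite -(plane_vol3 (m.1.1 * k1 + m.1.2 * k2 + m.2 * k3) m0).
apply: (@le_prod_lebesgue _ (mR * mR)%type leb2) => y [[[x1 x2] x3] _ ->] /=.
case: Hm; move: m n1 n2 n3 {m0 D} => [[a b] c] [[a1 b1] c1] [[a2 b2] c2] [[a3 b3] c3] /= h1 h2 h3.
rewrite /lin3 /=.
transitivity (x1 * (a * a1 + b * a2 + c * a3) + x2 * (a * b1 + b * b2 + c * b3)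
  + x3 * (a * c1 + b * c2 + c * c3) + (a * k1 + b * k2 + c * k3)); first by ring.
by rewrite h1 h2 h3; ring.
Qed.

End Volumes.

(** * Evaluation of simplex splines, independence of the lift, knot insertion *)

Section SplineEval.
Context {R : realType}.
Local Notation mR := (measurableTypeR R).
Local Notation mu := (@lebesgue_measure R).
Local Notation T3 := ((mR * mR) * mR)%type.

Lemma sum6 (f : 'I_6 -> R) : \sum_i f i =
  f (inord 0) + f (inord 1) + f (inord 2) + f (inord 3) + f (inord 4) + f (inord 5).
Proof.
rewrite !big_ord_recl big_ord0 addr0 !addrA.
by do !congr (_ + _); congr f; apply/val_inj; rewrite /= inordK.
Qed.

Lemma knots6E (l : seq (R * R)) k : (k < 6)%N -> knots6 l (inord k) = nth (0, 0) l k.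
Proof. by move=> k6; rewrite /knots6 inordK. Qed.

(** With [z] one extra coordinate of the lifted knots, the entries are the deviations of [u, v, w]
    from the affine function that takes the lifted values at [r, s, t]. *)
Definition lift_row (r s t u v w : R * R) (z : nat -> R) : (R * R) * R :=
  ((z 3%N - (bc1 r s t u * z 0%N + bc2 r s t u * z 1%N + bc3 r s t u * z 2%N),
    z 4%N - (bc1 r s t v * z 0%N + bc2 r s t v * z 1%N + bc3 r s t v * z 2%N)),
    z 5%N - (bc1 r s t w * z 0%N + bc2 r s t w * z 1%N + bc3 r s t w * z 2%N)).

Definition lift_cst (r s t x : R * R) (z : nat -> R) : R :=
  bc1 r s t x * z 0%N + bc2 r s t x * z 1%N + bc3 r s t x * z 2%N.

(** The slacks of the three face constraints of the fiber are exactly the weights of [r, s, t], so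
    nonnegativity of all six weights becomes membership in the fiber. *)
Lemma slice_simplex5 (r s t u v w x : R * R) (z : 'I_6 -> (R * R) * R) :
  orient r s t != 0 ->
  let z1 k := (z (inord k)).1.1 in
  let z2 k := (z (inord k)).1.2 in
  let z3 k := (z (inord k)).2 in
  [set y | simplex5 (knots6 [:: r; s; t; u; v; w]) z (x, y)] =
  [set y | exists2 q, fiber r s t u v w x q &
    y = ((lin3 (lift_row r s t u v w z1) q + lift_cst r s t x z1,
          lin3 (lift_row r s t u v w z2) q + lift_cst r s t x z2),
          lin3 (lift_row r s t u v w z3) q + lift_cst r s t x z3)].
Proof.
move=> D z1 z2 z3; apply/seteqP; split=> [y [lam []]|y [q [[q1 q2 q3] [f1 f2 f3]] ->]].
  rewrite !sum6 !knots6E //= => l0 l1.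
  have [L0 L1 L2] := And3 (l0 (inord 0)) (l0 (inord 1)) (l0 (inord 2)).
  have [L3 L4 L5] := And3 (l0 (inord 3)) (l0 (inord 4)) (l0 (inord 5)).
  move: l1 L0 L1 L2 L3 L4 L5.
  set a0 := lam (inord 0); set a1 := lam (inord 1); set a2 := lam (inord 2).
  set a3 := lam (inord 3); set a4 := lam (inord 4); set a5 := lam (inord 5).
  move=> l1 L0 L1 L2 L3 L4 L5 xE yE.
  have a0E : a0 = 1 - a1 - a2 - a3 - a4 - a5 by rewrite -l1; ring.
  pose q : T3 := ((a3, a4), a5).
  have B1 : bc1 r s t x = lin3 (nv (bc1 r s t) u v w) q + a0.
    by rewrite xE a0E /bc1 /nv /lin3 /=; move: D; rewrite /orient /= => D; field.
  have B2 : bc2 r s t x = lin3 (nv (bc2 r s t) u v w) q + a1.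
    by rewrite xE a0E /bc2 /nv /lin3 /=; move: D; rewrite /orient /= => D; field.
  have B3 : bc3 r s t x = lin3 (nv (bc3 r s t) u v w) q + a2.
    by rewrite xE a0E /bc3 /nv /lin3 /=; move: D; rewrite /orient /= => D; field.
  exists q; first by split; split=> //; rewrite ?B1 ?B2 ?B3; lra.
  rewrite yE /lift_cst B1 B2 B3 /lift_row /nv /lin3 /q /z1 /z2 /z3 /=.
  by congr ((_, _), _); ring.
pose c0 := bc1 r s t x - lin3 (nv (bc1 r s t) u v w) q.
pose c1 := bc2 r s t x - lin3 (nv (bc2 r s t) u v w) q.
pose c2 := bc3 r s t x - lin3 (nv (bc3 r s t) u v w) q.
exists (fun i : 'I_6 => nth 0 [:: c0; c1; c2; q.1.1; q.1.2; q.2] i).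
have su := bc_sum u D; have sv := bc_sum v D; have sw := bc_sum w D.
have sx := bc_sum x D.
have D3 p : bc3 r s t p = 1 - bc1 r s t p - bc2 r s t p.
  by rewrite -(bc_sum p D); ring.
have X1 (p : R * R) : p.1 = bc1 r s t p * r.1 + bc2 r s t p * s.1 + bc3 r s t p * t.1.
  by rewrite /bc1 /bc2 /bc3; move: D; rewrite /orient => D; field.
have X2 (p : R * R) : p.2 = bc1 r s t p * r.2 + bc2 r s t p * s.2 + bc3 r s t p * t.2.
  by rewrite /bc1 /bc2 /bc3; move: D; rewrite /orient => D; field.
split.
- case=> -[|[|[|[|[|[|//]]]]]] /= _; rewrite /c0 /c1 /c2 ?subr_ge0 //.
- rewrite sum6 !inordK //= /c0 /c1 /c2 /lin3 /nv /= !D3; ring.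
- rewrite !sum6 !knots6E // !inordK //=.
  transitivity (x.1, x.2); first by case: (x).
  congr (_, _).
    by rewrite (X1 u) (X1 v) (X1 w) (X1 x) /c0 /c1 /c2 /lin3 /nv /=; ring.
  by rewrite (X2 u) (X2 v) (X2 w) (X2 x) /c0 /c1 /c2 /lin3 /nv /=; ring.
- rewrite !sum6 !inordK //= /lift_cst /lift_row /lin3 /z1 /z2 /z3 /c0 /c1 /c2 /lin3 /nv /=.
  by congr ((_, _), _); ring.
Qed.

Lemma vol5E (S : set ((R * R) * ((R * R) * R))) :
  vol5 S = (\int[leb2]_x vol3 [set y | S (x, y)])%E.
Proof.
apply: eq_integral => x _ /=; rewrite -leb3E /leb3 /leb2 /leb; congr (_ _).
by apply/seteqP; split=> y; rewrite /xsection /= inE.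
Qed.

Lemma fiber_sub_cube (r s t u v w x : R * R) : orient r s t != 0 ->
  fiber r s t u v w x `<=` cube.
Proof.
move=> D q [[q1 q2 q3] [f1 f2 f3]].
have H : q.1.1 + q.1.2 + q.2 <= 1.
  rewrite -(bc_sum x D).
  apply: le_trans (lerD (lerD f1 f2) f3); rewrite /lin3 /nv /=.
  have := bc_sum u D; have := bc_sum v D; have := bc_sum w D.
  move=> w1 v1 u1.
  rewrite [leRHS](_ : _ = q.1.1 * (bc1 r s t u + bc2 r s t u + bc3 r s t u)
        + q.1.2 * (bc1 r s t v + bc2 r s t v + bc3 r s t v)
        + q.2 * (bc1 r s t w + bc2 r s t w + bc3 r s t w)); last by ring.
  by rewrite u1 v1 w1 !mulr1.
rewrite /cube /=; split; first split; rewrite /= in_itv /=; lra.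
Qed.

Lemma vol3_cube : vol3 (cube : set T3) = 1%E.
Proof.
have I1 : leb ([set` `[0, 1]] : set mR) = 1%:E.
  by rewrite /leb lebesgue_measure_itv /= lte_fin ltr01 sube0.
by rewrite /cube vol3_box ?I1 ?mul1e //; exact: measurable_itv.
Qed.

Lemma le_vol3 (A B : set T3) : A `<=` B -> (vol3 A <= vol3 B)%E.
Proof. exact: (@le_prod_lebesgue _ _ (mR * mR)%type leb2). Qed.

Lemma fin_vol3 (A : set T3) : A `<=` cube -> vol3 A \is a fin_num.
Proof.
move=> AC; rewrite ge0_fin_numE; last exact: (measure_ge0 leb3).
by apply: le_lt_trans (le_vol3 AC) _; rewrite vol3_cube ltry.
Qed.

(** The determinant of the lift rows decides: if nonzero, all slices are fibers scaled by one factor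
    [c], which will cancel in the quotient; if zero, every slice is flat. The second case records
    the vanishing determinant so that an admissible lift can be exhibited by computing it. *)
Lemma lift_dichotomy (r s t u v w : R * R) (z : 'I_6 -> (R * R) * R)
    (xi := knots6 [:: r; s; t; u; v; w]) : orient r s t != 0 ->
  (exists2 c : R, 0 < c & (forall y, vol3 [set q | simplex5 xi z (y, q)]
      = c%:E * vol3 (fiber r s t u v w y))%E /\
      vol5 (simplex5 xi z) = (c * (`|orient r s t| / 120))%:E) \/
  (vol5 (simplex5 xi z) = 0%E /\ det3
      (lift_row r s t u v w (fun k => (z (inord k)).1.1))
      (lift_row r s t u v w (fun k => (z (inord k)).1.2))
      (lift_row r s t u v w (fun k => (z (inord k)).2)) = 0).
Proof.
move=> D; have S y := slice_simplex5 u v w y z D.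
case: (eqVneq (det3
  (lift_row r s t u v w (fun k => (z (inord k)).1.1))
  (lift_row r s t u v w (fun k => (z (inord k)).1.2))
  (lift_row r s t u v w (fun k => (z (inord k)).2))) 0) => [A0|A0]; [right|left].
  split=> //; rewrite vol5E integral0_eq // => y _.
  by rewrite S; exact: vol3_image_degenerate.
have [c c0 Hc] := scales_image A0; exists c => //.
have E y : vol3 [set q | simplex5 xi z (y, q)] = (c%:E * vol3 (fiber r s t u v w y))%E.
  by rewrite S; apply: Hc; exact: measurable_fiber.
split=> //; rewrite vol5E; under eq_integral do rewrite E.
have mF : measurable_fun (setT : set (mR * mR)) (fun y => vol3 (fiber r s t u v w y)).
  rewrite (_ : (fun y => _) = leb3 \o xsection [set p | fiber r s t u v w p.1 p.2]).
    by apply: measurable_fun_xsection; exact: measurable_fiber2.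
  apply/funext => y /=; rewrite leb3E; congr (vol3 _).
  by apply/seteqP; split=> q; rewrite /xsection /= inE.
rewrite ge0_integralZl // ?lee_fin ?ltW//.
by rewrite integral_fiber // -EFinM.
Qed.

Lemma lift_ok_exists (r s t u v w : R * R) : orient r s t != 0 ->
  exists z, lift_ok (knots6 [:: r; s; t; u; v; w]) z.
Proof.
(* With [r, s, t] lifted by zero and [u, v, w] by unit vectors the lift rows form the identity
   matrix. *)
move=> D; pose z (i : 'I_6) : (R * R) * R := nth ((0, 0), 0)
  [:: ((0, 0), 0); ((0, 0), 0); ((0, 0), 0); ((1, 0), 0); ((0, 1), 0); ((0, 0), 1)] i.
exists z; have [[c c0 [_ V]]|[_]] := lift_dichotomy u v w z D.
  by rewrite /lift_ok V lte_fin mulr_gt0// divr_gt0 // normr_gt0.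
rewrite /det3 /lift_row /z /= !inordK //= => /eqP; rewrite !(mulr0, subr0, addr0, mulr1).
by rewrite oner_eq0.
Qed.

(** The lift is left arbitrary because a lift chosen for a permuted list is admissible but otherwise
    unknown. *)
Lemma spline_eval_lift (r s t u v w x : R * R) (z : 'I_6 -> (R * R) * R)
    (xi := knots6 [:: r; s; t; u; v; w]) :
  orient r s t != 0 -> lift_ok xi z ->
  fine (vol3 [set q | simplex5 xi z (x, q)]) / fine (vol5 (simplex5 xi z))
  = 120 / `|orient r s t| * fine (vol3 (fiber r s t u v w x)).
Proof.
move=> D; have d0 : 0 < `|orient r s t| by rewrite normr_gt0.
have [[c c0 [H V]] _|[V _]] := lift_dichotomy u v w z D; last by rewrite /lift_ok V ltxx.
rewrite H V /= fineM //; last by apply: fin_vol3; exact: fiber_sub_cube.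
by rewrite /=; field; rewrite !gt_eqF.
Qed.

Lemma spline_eval (r s t u v w x : R * R) : orient r s t != 0 ->
  simplex_spline (knots6 [:: r; s; t; u; v; w]) x
  = 120 / `|orient r s t| * fine (vol3 (fiber r s t u v w x)).
Proof.
move=> D; apply: spline_eval_lift => //.
by apply: ClassicalEpsilon.epsilon_spec; exact: lift_ok_exists.
Qed.

Lemma simplex5_perm (p : {perm 'I_6}) (xi : 'I_6 -> R * R) z :
  simplex5 (xi \o p) (z \o p) = simplex5 xi z.
Proof.
have sub (p' : {perm 'I_6}) (xi' : 'I_6 -> R * R) z' :
    simplex5 xi' z' `<=` simplex5 (xi' \o p') (z' \o p').
  move=> w [lam [l0 l1 w1 w2]]; exists (lam \o p'); split=> /=.
  - by move=> i; exact: l0.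
  - by rewrite -l1 [RHS](reindex_perm p').
  - rewrite w1; congr (_, _); by rewrite [LHS](reindex_perm p').
  - rewrite w2; congr ((_, _), _); by rewrite [LHS](reindex_perm p').
apply/seteqP; split; last exact: sub.
have := sub (p^-1)%g (xi \o p) (z \o p).
by congr (_ `<=` simplex5 _ _); apply/funext => i /=; rewrite permKV.
Qed.

(** The lifts chosen for the two lists are unrelated; the one for [l] is transported along the
    permutation to an admissible lift of the other list, where the value does not depend on it. *)
Lemma spline_perm (l : seq (R * R)) (r s t u v w x : R * R) :
  orient r s t != 0 -> perm_eq l [:: r; s; t; u; v; w] ->
  simplex_spline (knots6 l) x = simplex_spline (knots6 [:: r; s; t; u; v; w]) x.
Proof.
move=> D /(@tuple_permP _ _ _ [tuple of [:: r; s; t; u; v; w]])[p lE].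
have xiE : knots6 l = knots6 [:: r; s; t; u; v; w] \o p.
  apply/funext => i; rewrite /knots6 lE /= -(tnth_nth _ [tuple tnth _ (p i0)  | i0 < 6]).
  by rewrite tnth_mktuple (tnth_nth (0, 0)).
rewrite {}xiE spline_eval //; set xi := knots6 _.
have [z0 ok0] := lift_ok_exists u v w D.
have ok : lift_ok (xi \o p) (chosen_lift (xi \o p)).
  apply: ClassicalEpsilon.epsilon_spec; exists (z0 \o p).
  by rewrite /lift_ok simplex5_perm.
have zE : chosen_lift (xi \o p) = (chosen_lift (xi \o p) \o (p^-1)%g) \o p.
  by apply/funext => i /=; rewrite permK.
have ok' : lift_ok xi (chosen_lift (xi \o p) \o (p^-1)%g).
  by rewrite /lift_ok -(simplex5_perm p) -zE.
rewrite /simplex_spline zE !simplex5_perm.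
exact: (spline_eval_lift x D ok').
Qed.

Lemma vol3U0 (A B : set T3) : measurable A -> measurable B ->
  A `|` B `<=` cube -> vol3 (A `&` B) = 0%E ->
  fine (vol3 (A `|` B)) = fine (vol3 A) + fine (vol3 B).
Proof.
move=> mA mB AB I0.
have mBA : measurable (B `\` A) by exact: measurableD.
have BE : leb3 B = leb3 (B `\` A).
  rewrite -[in LHS](setUIDK B A) measureU //; last 2 first.
  - exact: measurableI.
  - by rewrite setDE setIACA setICr setI0.
  by rewrite setIC [X in (X + _)%E]I0 add0e.
rewrite -fineD; last 2 first.
- by apply: fin_vol3 => q Aq; apply: AB; left.
- by apply: fin_vol3 => q Bq; apply: AB; right.
rewrite -leb3E BE -measureU //; last by rewrite setDE setICA setICr setI0.
congr (fine (leb3 _)); apply/seteqP; split=> q; last by case=> [|[]]; [left|right].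
by have [Aq|nAq] := pselect (A q); [left|case=> // Bq; right].
Qed.

Lemma spline_insert (a b t u v w x xi : R * R) (al be : R) :
  orient a b t != 0 -> 0 < al -> 0 < be -> al + be = 1 ->
  xi = (al * a.1 + be * b.1, al * a.2 + be * b.2) -> orient x xi t != 0 ->
  simplex_spline (knots6 [:: a; b; t; u; v; w]) x
  = al * simplex_spline (knots6 [:: xi; b; t; u; v; w]) x
    + be * simplex_spline (knots6 [:: a; xi; t; u; v; w]) x.
Proof.
move=> D al0 be0 albe xiE Dx.
have beE : be = 1 - al by rewrite -albe; ring.
have al0' : al != 0 by rewrite gt_eqF.
have be0' : be != 0 by rewrite gt_eqF.
have E1 : orient xi b t = al * orient a b t by rewrite xiE /orient /= beE; ring.
have E2 : orient a xi t = be * orient a b t.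
  by rewrite xiE /orient /= (_ : al = 1 - be) ?beE //; ring.
have D1 : orient xi b t != 0 by rewrite E1 mulf_neq0.
have D2 : orient a xi t != 0 by rewrite E2 mulf_neq0.
rewrite !spline_eval // E1 E2 !normrM (gtr0_norm al0) (gtr0_norm be0).
set F := fiber a b t u v w x; set F1 := fiber xi b t u v w x; set F2 := fiber a xi t u v w x.
(* Since [a = (xi - be b) / al], weight [lambda] at [a] becomes [lambda / al] at [xi] and takes
   [be / al * lambda] away from [b]; the B relations are symmetric. *)
have A1 y : bc1 xi b t y = bc1 a b t y / al.
  by rewrite /bc1 E1; field; rewrite D al0'.
have A2 y : bc2 xi b t y = bc2 a b t y - be / al * bc1 a b t y.
  rewrite /bc2 /bc1 E1 (_ : orient xi y t = al * orient a y t - be * orient y b t).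
    by field; rewrite D al0'.
  by rewrite xiE /orient /= beE; ring.
have A3 y : bc3 xi b t y = bc3 a b t y.
  rewrite /bc3 E1 (_ : orient xi b y = al * orient a b y).
    by field; rewrite D al0'.
  by rewrite xiE /orient /= beE; ring.
have B1 y : bc1 a xi t y = bc1 a b t y - al / be * bc2 a b t y.
  rewrite /bc2 /bc1 E2 (_ : orient y xi t = be * orient y b t - al * orient a y t).
    by field; rewrite D be0'.
  by rewrite xiE /orient /= beE; ring.
have B2 y : bc2 a xi t y = bc2 a b t y / be.
  by rewrite /bc2 E2; field; rewrite D be0'.
have B3 y : bc3 a xi t y = bc3 a b t y.
  rewrite /bc3 E2 (_ : orient a xi y = be * orient a b y).
    by field; rewrite D be0'.
  by rewrite xiE /orient /= beE; ring.
(* The weights of [a, b, t]. The cut compares [be * G1] with [al * G2], and the coefficients of the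
   relation cancel against the factors [al], [be] of the smaller determinants. *)
pose G1 q := bc1 a b t x - lin3 (nv (bc1 a b t) u v w) q.
pose G2 q := bc2 a b t x - lin3 (nv (bc2 a b t) u v w) q.
pose G3 q := bc3 a b t x - lin3 (nv (bc3 a b t) u v w) q.
have FE q : F q <-> [/\ 0 <= q.1.1, 0 <= q.1.2 & 0 <= q.2] /\ [/\ 0 <= G1 q, 0 <= G2 q & 0 <= G3 q].
  by rewrite /G1 /G2 /G3 !subr_ge0.
have F1E q : F1 q <-> [/\ 0 <= q.1.1, 0 <= q.1.2 & 0 <= q.2] /\
    [/\ 0 <= G1 q, be * G1 q <= al * G2 q & 0 <= G3 q].
  rewrite /F1 /fiber /=.
  have -> : lin3 (nv (bc1 xi b t) u v w) q <= bc1 xi b t x = (0 <= G1 q).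
    rewrite -subr_ge0 (_ : _ - _ = G1 q / al) ?pmulr_lge0 ?invr_gt0 //.
    by rewrite /G1 /lin3 /nv /= !A1; field; exact: al0'.
  have -> : lin3 (nv (bc2 xi b t) u v w) q <= bc2 xi b t x = (be * G1 q <= al * G2 q).
    rewrite -subr_ge0 -[RHS]subr_ge0 -(pmulr_rge0 _ al0); congr (0 <= _).
    by rewrite /G1 /G2 /lin3 /nv /= !A2; field; exact: al0'.
  have -> : lin3 (nv (bc3 xi b t) u v w) q <= bc3 xi b t x = (0 <= G3 q).
    by rewrite /G3 subr_ge0 /lin3 /nv /= !A3.
  by [].
have F2E q : F2 q <-> [/\ 0 <= q.1.1, 0 <= q.1.2 & 0 <= q.2] /\
    [/\ al * G2 q <= be * G1 q, 0 <= G2 q & 0 <= G3 q].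
  rewrite /F2 /fiber /=.
  have -> : lin3 (nv (bc1 a xi t) u v w) q <= bc1 a xi t x = (al * G2 q <= be * G1 q).
    rewrite -subr_ge0 -[RHS]subr_ge0 -(pmulr_rge0 _ be0); congr (0 <= _).
    by rewrite /G1 /G2 /lin3 /nv /= !B1; field; exact: be0'.
  have -> : lin3 (nv (bc2 a xi t) u v w) q <= bc2 a xi t x = (0 <= G2 q).
    rewrite -subr_ge0 (_ : _ - _ = G2 q / be) ?pmulr_lge0 ?invr_gt0 //.
    by rewrite /G2 /lin3 /nv /= !B2; field; exact: be0'.
  have -> : lin3 (nv (bc3 a xi t) u v w) q <= bc3 a xi t x = (0 <= G3 q).
    by rewrite /G3 subr_ge0 /lin3 /nv /= !B3.
  by [].
have FU : F = F1 `|` F2.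
  apply/seteqP; split=> q.
    move=> /FE[q0 [g1 g2 g3]]; have [h|h] := leP (be * G1 q) (al * G2 q).
      by left; apply/F1E.
    by right; apply/F2E; split=> //; split=> //; exact: ltW.
  case=> [/F1E|/F2E] [q0 [g1 g2 g3]]; apply/FE; split=> //; split=> //.
    by rewrite -(pmulr_rge0 _ al0); apply: le_trans g2; rewrite mulr_ge0 // ltW.
  by rewrite -(pmulr_rge0 _ be0); apply: le_trans g1; rewrite mulr_ge0 // ltW.
have I0 : vol3 (F1 `&` F2) = 0%E.
  pose n : (R * R) * R := nv (fun y => al * bc2 a b t y - be * bc1 a b t y) u v w.
  pose k := al * bc2 a b t x - be * bc1 a b t x.
  have sub : F1 `&` F2 `<=` [set q | lin3 n q = k].
    move=> q [/F1E[_ [_ h1 _]] /F2E[_ [h2 _ _]]] /=.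
    have h : al * G2 q = be * G1 q by apply/le_anti; rewrite h1 h2.
    move: h; rewrite /G1 /G2 /k /n /lin3 /nv /= => h; apply/eqP; rewrite -subr_eq0.
    move/eqP: h; rewrite -subr_eq0 => /eqP h; apply/eqP; rewrite -[RHS]oppr0 -h; ring.
  (* The affine function behind [n] vanishes exactly on the line through [xi] and [t]. If [u, v, w]
     all lie there, the cut is no plane; then [k], proportional to [orient x xi t], is nonzero and
     the pieces are disjoint. *)
  have [n0|n0] := eqVneq n 0; last first.
    by apply/le_anti/andP; split; [rewrite -(plane_vol3 k n0); exact: le_vol3|exact: (measure_ge0 leb3)].
  rewrite (_ : _ `&` _ = set0) ?(measure0 leb3)//.
  apply/seteqP; split=> // q /sub /=; rewrite n0 /lin3 /= !mul0r !addr0 => k0.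
  move: Dx; have -> : orient x xi t = - orient a b t * k.
    rewrite /k /bc1 /bc2 xiE beE; move: D; rewrite /orient /= => D; field; exact: D.
  by rewrite -k0 mulr0 eqxx.
have mF1 : measurable F1 by exact: measurable_fiber.
have mF2 : measurable F2 by exact: measurable_fiber.
have d0 : `|orient a b t| != 0 by rewrite normr_eq0.
rewrite FU (vol3U0 mF1 mF2) //; first by field; rewrite d0 al0' be0'.
by rewrite -FU; exact: fiber_sub_cube.
Qed.

End SplineEval.

(** * Integer certificates for the expansions of the Bernstein splines *)

Section Combinatorics.

(** Three times the barycentric coordinates, to stay in the integers; knots are numbered around the
    boundary, with the vertices at 0, 3, 6. *)
Definition knot_weights (n : nat) : int * int * int :=
  nth (0, 0, 0) [:: (3, 0, 0); (2, 1, 0); (1, 2, 0); (0, 3, 0); (0, 2, 1); (0, 1, 2);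
    (0, 0, 3); (1, 0, 2); (2, 0, 1)]%Z n.

Definition knot_det (a b c : nat) : int :=
  let: (a1, a2, a3) := knot_weights a in let: (b1, b2, b3) := knot_weights b in
  let: (c1, c2, c3) := knot_weights c in
  a1 * (b2 * c3 - b3 * c2) - a2 * (b1 * c3 - b3 * c1) + a3 * (b1 * c2 - b2 * c1).

Definition on_segment (a b k na nb : nat) : bool :=
  let: (a1, a2, a3) := knot_weights a in let: (b1, b2, b3) := knot_weights b in
  let: (k1, k2, k3) := knot_weights k in
  [&& (0 < na)%N, (0 < nb)%N, (na + nb)%:Z * k1 == na%:Z * a1 + nb%:Z * b1,
    (na + nb)%:Z * k2 == na%:Z * a2 + nb%:Z * b2
  & (na + nb)%:Z * k3 == na%:Z * a3 + nb%:Z * b3].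

(* (c, [a; b; k; na; nb; t; u; v; w]) encodes c times the insertion of knot k, with
   (na + nb) k = na a + nb b, into the edge ab of the knot list a b t u v w; malformed or
   degenerate entries contribute nothing. *)
Definition insertion_rel (e : int * seq nat) : seq (int * seq nat) :=
  if e.2 is [:: a; b; k; na; nb; t; u; v; w] then
    if [&& all (fun i => i < 9)%N [:: a; b; k; t; u; v; w], k != t,
         knot_det a b t != 0 & on_segment a b k na nb]
    then [:: (e.1 * (na + nb)%:Z, sort leq [:: a; b; t; u; v; w]);
             (- e.1 * na%:Z, sort leq [:: k; b; t; u; v; w]);
             (- e.1 * nb%:Z, sort leq [:: a; k; t; u; v; w])]
    else [::]
  else [::].

(** Each round collects all coefficients of the leading knot list and then removes that list; [n] is
    fuel for the rounds. *)
Fixpoint formal_zero (n : nat) (F : seq (int * seq nat)) : bool :=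
  if F is ck :: _ then
    if n is m.+1 then
      (foldr (fun dk s => if dk.2 == ck.2 then dk.1 + s else s) 0 F == 0)
      && formal_zero m [seq dk <- F | dk.2 != ck.2]
    else false
  else true.

Definition opp_formal (F : seq (int * seq nat)) := [seq (- ck.1, ck.2) | ck <- F].

(** The fuel 200 exceeds the number of terms, at most 29 from an expansion and 3 for each of at most
    43 insertions. *)
Definition certifies (cert target : seq (int * seq nat)) : bool :=
  formal_zero 200 (target ++ opp_formal (flatten (map insertion_rel cert))).

(* The symmetries of the triangle act on the nine knots, listed cyclically along the
   boundary, as the dihedral maps i |-> 3 k + i and i |-> 3 k - i modulo 9. *)
Definition dihedral (f : bool) (k i : nat) : nat :=
  (((if f then 9 - i else i) + 3 * k) %% 9)%N.

(** The ten cubic Bernstein polynomials form three orbits, of sizes 3, 6 and 1. The entries [na] and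
    [nb] are masses, not knots, and stay fixed. *)
Definition map_cert (f : bool) (k : nat) (cert : seq (int * seq nat)) :=
  [seq (e.1, if e.2 is a :: b :: c :: na :: nb :: r
             then [:: dihedral f k a, dihedral f k b, dihedral f k c, na, nb & map (dihedral f k) r]
             else [::]) | e <- cert].

(** The digits are the exponents of the Bernstein polynomial that is expanded. *)
Definition cert300 : seq (int * seq nat) := [::
    (54%Z, [:: 0; 3; 1; 2; 1; 8; 0; 0; 0]%N);
    (162%Z, [:: 6; 0; 8; 1; 2; 3; 0; 0; 0]%N);
    (36%Z, [:: 0; 3; 2; 1; 2; 8; 0; 0; 1]%N);
    (16%Z, [:: 0; 3; 2; 1; 2; 5; 1; 7; 8]%N);
    (16%Z, [:: 6; 0; 7; 2; 1; 1; 2; 4; 8]%N);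
    (8%Z, [:: 4; 6; 5; 1; 1; 1; 2; 7; 8]%N);
    (72%Z, [:: 6; 0; 7; 2; 1; 1; 0; 3; 8]%N);
    (36%Z, [:: 6; 0; 7; 2; 1; 1; 0; 0; 8]%N);
    (108%Z, [:: 0; 3; 1; 2; 1; 6; 0; 0; 8]%N);
    (24%Z, [:: 3; 6; 5; 1; 2; 0; 1; 7; 8]%N);
    (48%Z, [:: 0; 3; 2; 1; 2; 7; 0; 1; 8]%N);
    (-24%Z, [:: 6; 0; 7; 2; 1; 1; 2; 3; 8]%N);
    (24%Z, [:: 3; 6; 4; 2; 1; 0; 1; 2; 8]%N);
    (-8%Z, [:: 3; 6; 5; 1; 2; 1; 2; 7; 8]%N)].

Definition cert210 : seq (int * seq nat) := [::
    (162%Z, [:: 0; 3; 1; 2; 1; 6; 0; 2; 3]%N);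
    (270%Z, [:: 6; 0; 8; 1; 2; 1; 0; 2; 3]%N);
    (486%Z, [:: 0; 3; 2; 1; 2; 6; 0; 0; 3]%N);
    (72%Z, [:: 6; 0; 7; 2; 1; 1; 0; 2; 8]%N);
    (-36%Z, [:: 0; 3; 2; 1; 2; 6; 1; 7; 8]%N);
    (36%Z, [:: 3; 6; 5; 1; 2; 0; 1; 7; 8]%N);
    (180%Z, [:: 3; 6; 4; 2; 1; 0; 1; 2; 8]%N);
    (152%Z, [:: 6; 0; 7; 2; 1; 1; 2; 4; 8]%N);
    (88%Z, [:: 0; 3; 2; 1; 2; 5; 1; 7; 8]%N);
    (-44%Z, [:: 3; 6; 5; 1; 2; 1; 2; 7; 8]%N);
    (108%Z, [:: 4; 6; 5; 1; 1; 1; 2; 7; 8]%N);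
    (108%Z, [:: 6; 0; 8; 1; 2; 1; 0; 0; 2]%N);
    (324%Z, [:: 0; 3; 1; 2; 1; 6; 0; 0; 2]%N);
    (72%Z, [:: 6; 0; 8; 1; 2; 1; 2; 3; 4]%N);
    (-144%Z, [:: 0; 3; 2; 1; 2; 4; 1; 6; 8]%N);
    (108%Z, [:: 3; 6; 4; 2; 1; 0; 1; 2; 3]%N);
    (-192%Z, [:: 4; 6; 5; 1; 1; 0; 1; 2; 8]%N);
    (-64%Z, [:: 6; 0; 7; 2; 1; 1; 2; 5; 8]%N);
    (96%Z, [:: 0; 3; 2; 1; 2; 4; 1; 5; 8]%N);
    (48%Z, [:: 6; 0; 7; 2; 1; 1; 4; 5; 8]%N);
    (32%Z, [:: 3; 6; 4; 2; 1; 1; 2; 7; 8]%N);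
    (-32%Z, [:: 0; 3; 2; 1; 2; 4; 1; 7; 8]%N);
    (-96%Z, [:: 3; 5; 4; 1; 1; 0; 1; 7; 8]%N);
    (144%Z, [:: 3; 6; 5; 1; 2; 0; 1; 4; 8]%N)].

Definition cert111 : seq (int * seq nat) := [::
    (12%Z, [:: 6; 0; 8; 1; 2; 4; 5; 6; 7]%N);
    (36%Z, [:: 3; 6; 5; 1; 2; 0; 4; 6; 7]%N);
    (-8%Z, [:: 3; 6; 4; 2; 1; 1; 2; 7; 8]%N);
    (-24%Z, [:: 0; 3; 2; 1; 2; 6; 1; 7; 8]%N);
    (-6%Z, [:: 6; 0; 7; 2; 1; 1; 2; 3; 4]%N);
    (10%Z, [:: 6; 8; 7; 1; 1; 1; 2; 4; 5]%N);
    (20%Z, [:: 3; 6; 5; 1; 2; 1; 2; 4; 8]%N);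
    (16%Z, [:: 3; 6; 5; 1; 2; 1; 2; 4; 7]%N);
    (30%Z, [:: 6; 0; 8; 1; 2; 1; 2; 3; 4]%N);
    (24%Z, [:: 0; 3; 2; 1; 2; 4; 5; 6; 7]%N);
    (32%Z, [:: 6; 0; 8; 1; 2; 2; 4; 5; 7]%N);
    (-6%Z, [:: 3; 6; 4; 2; 1; 0; 1; 7; 8]%N);
    (-72%Z, [:: 1; 3; 2; 1; 1; 4; 6; 7; 8]%N);
    (12%Z, [:: 0; 3; 1; 2; 1; 4; 6; 7; 8]%N);
    (-24%Z, [:: 3; 6; 5; 1; 2; 2; 4; 7; 8]%N);
    (-8%Z, [:: 0; 3; 2; 1; 2; 4; 5; 7; 8]%N);
    (-12%Z, [:: 3; 6; 5; 1; 2; 0; 4; 7; 8]%N);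
    (-2%Z, [:: 0; 3; 2; 1; 2; 4; 1; 7; 8]%N);
    (108%Z, [:: 0; 3; 1; 2; 1; 6; 0; 3; 7]%N);
    (36%Z, [:: 0; 3; 2; 1; 2; 6; 0; 1; 7]%N);
    (24%Z, [:: 6; 0; 8; 1; 2; 1; 0; 2; 7]%N);
    (162%Z, [:: 6; 0; 7; 2; 1; 3; 0; 3; 6]%N);
    (54%Z, [:: 3; 6; 4; 2; 1; 0; 3; 6; 7]%N);
    (-24%Z, [:: 0; 2; 1; 1; 1; 4; 5; 6; 7]%N);
    (8%Z, [:: 0; 2; 1; 1; 1; 4; 5; 7; 8]%N);
    (-8%Z, [:: 6; 0; 8; 1; 2; 1; 4; 5; 7]%N);
    (54%Z, [:: 0; 3; 2; 1; 2; 4; 1; 6; 7]%N);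
    (12%Z, [:: 3; 6; 4; 2; 1; 0; 1; 2; 7]%N);
    (-36%Z, [:: 6; 0; 7; 2; 1; 1; 3; 3; 4]%N);
    (72%Z, [:: 3; 6; 4; 2; 1; 0; 1; 3; 7]%N);
    (12%Z, [:: 3; 6; 5; 1; 2; 1; 2; 3; 4]%N);
    (36%Z, [:: 0; 3; 2; 1; 2; 4; 1; 3; 6]%N);
    (18%Z, [:: 0; 3; 1; 2; 1; 4; 3; 6; 7]%N);
    (44%Z, [:: 6; 0; 8; 1; 2; 1; 2; 4; 7]%N);
    (56%Z, [:: 1; 3; 2; 1; 1; 4; 5; 7; 8]%N);
    (56%Z, [:: 3; 6; 5; 1; 2; 1; 4; 7; 8]%N);
    (-6%Z, [:: 0; 3; 1; 2; 1; 4; 2; 5; 6]%N);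
    (4%Z, [:: 0; 3; 1; 2; 1; 4; 2; 5; 7]%N);
    (6%Z, [:: 6; 0; 7; 2; 1; 2; 3; 4; 5]%N);
    (-2%Z, [:: 6; 0; 7; 2; 1; 1; 2; 4; 5]%N);
    (10%Z, [:: 3; 5; 4; 1; 1; 1; 2; 7; 8]%N);
    (20%Z, [:: 0; 3; 2; 1; 2; 5; 1; 7; 8]%N);
    (30%Z, [:: 3; 6; 5; 1; 2; 0; 1; 7; 8]%N)].

Definition knot_lists : seq (seq nat) := [::
    [:: 0; 0; 0; 0; 1; 8];
    [:: 3; 3; 3; 3; 2; 4];
    [:: 6; 6; 6; 6; 5; 7];
    [:: 0; 0; 0; 1; 2; 8];
    [:: 0; 0; 0; 8; 7; 1];
    [:: 3; 3; 3; 4; 5; 2];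
    [:: 3; 3; 3; 2; 1; 4];
    [:: 6; 6; 6; 7; 8; 5];
    [:: 6; 6; 6; 5; 4; 7];
    [:: 0; 0; 1; 2; 3; 8];
    [:: 0; 0; 8; 7; 6; 1];
    [:: 3; 3; 4; 5; 6; 2];
    [:: 3; 3; 2; 1; 0; 4];
    [:: 6; 6; 7; 8; 0; 5];
    [:: 6; 6; 5; 4; 3; 7];
    [:: 0; 0; 1; 2; 8; 7];
    [:: 3; 3; 2; 1; 4; 5];
    [:: 6; 6; 5; 4; 7; 8];
    [:: 0; 3; 1; 2; 8; 4];
    [:: 3; 6; 4; 5; 2; 7];
    [:: 6; 0; 7; 8; 5; 1];
    [:: 0; 1; 2; 4; 7; 8];
    [:: 0; 8; 7; 5; 2; 1];
    [:: 3; 4; 5; 7; 1; 2];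
    [:: 3; 1; 2; 4; 5; 8];
    [:: 6; 7; 8; 1; 4; 5];
    [:: 6; 4; 5; 7; 8; 2];
    [:: 1; 2; 4; 5; 7; 8]]%N.

(* Rearrangements of [knot_lists]: the first three knots are affinely independent, and
   each of their barycentric coordinates either is nonzero at one of the last three knots
   or is nonnegative on the triangle. *)
Definition knot_arrangements : seq (seq nat) := [::
    [:: 0; 1; 8; 0; 0; 0];
    [:: 3; 2; 4; 3; 3; 3];
    [:: 6; 5; 7; 6; 6; 6];
    [:: 0; 1; 8; 0; 0; 2];
    [:: 0; 8; 1; 0; 0; 7];
    [:: 3; 4; 2; 3; 3; 5];
    [:: 3; 2; 4; 3; 3; 1];
    [:: 6; 7; 5; 6; 6; 8];
    [:: 6; 5; 7; 6; 6; 4];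
    [:: 0; 1; 8; 0; 2; 3];
    [:: 0; 8; 1; 0; 7; 6];
    [:: 3; 4; 2; 3; 5; 6];
    [:: 3; 2; 4; 3; 1; 0];
    [:: 6; 7; 5; 6; 8; 0];
    [:: 6; 5; 7; 6; 4; 3];
    [:: 0; 1; 8; 0; 2; 7];
    [:: 3; 2; 4; 3; 1; 5];
    [:: 6; 5; 7; 6; 4; 8];
    [:: 0; 3; 8; 1; 2; 4];
    [:: 3; 6; 2; 4; 5; 7];
    [:: 6; 0; 5; 7; 8; 1];
    [:: 0; 1; 4; 2; 7; 8];
    [:: 0; 8; 5; 7; 2; 1];
    [:: 3; 4; 7; 5; 1; 2];
    [:: 3; 1; 4; 2; 5; 8];
    [:: 6; 7; 1; 8; 4; 5];
    [:: 6; 4; 7; 5; 8; 2];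
    [:: 1; 2; 4; 5; 7; 8]]%N.

Definition expansion (N : nat) (b c : seq nat) : seq (int * seq nat) :=
  (N%:Z, sort leq b) :: [seq (- ck.1%:Z, sort leq ck.2) | ck <- zip c knot_lists].

(* An entry (cert, (N, b, c)) states that N times the Bernstein spline with knot list b
   is the combination of the 28 simplex splines with coefficients c. *)
Definition expansions : seq (seq (int * seq nat) * (nat * seq nat * seq nat)) := [::
    (map_cert false 0 cert300,
     (486, [:: 0; 3; 6; 0; 0; 0],
      [:: 54; 0; 0; 72; 72; 0; 0; 0; 0; 36; 36; 0; 0; 0; 0; 96; 0; 0; 24; 0; 24; 32; 32; 0; 0; 0; 0; 8]));
    (map_cert false 1 cert300,
     (486, [:: 3; 0; 6; 3; 3; 3],
      [:: 0; 54; 0; 0; 0; 72; 72; 0; 0; 0; 0; 36; 36; 0; 0; 0; 96; 0; 24; 24; 0; 0; 0; 32; 32; 0; 0; 8]));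
    (map_cert false 2 cert300,
     (486, [:: 6; 0; 3; 6; 6; 6],
      [:: 0; 0; 54; 0; 0; 0; 0; 72; 72; 0; 0; 0; 0; 36; 36; 0; 0; 96; 0; 24; 24; 0; 0; 0; 0; 32; 32; 8]));
    (map_cert false 0 cert210,
     (1458, [:: 0; 3; 6; 0; 0; 3],
      [:: 0; 0; 0; 108; 0; 0; 0; 0; 0; 270; 0; 0; 108; 0; 0; 144; 0; 0; 252; 0; 36; 240; 48; 0; 96; 48; 0; 108]));
    (map_cert false 1 cert210,
     (1458, [:: 3; 6; 0; 3; 3; 6],
      [:: 0; 0; 0; 0; 0; 108; 0; 0; 0; 0; 0; 270; 0; 0; 108; 0; 144; 0; 36; 252; 0; 48; 0; 240; 48; 0; 96; 108]));
    (map_cert false 2 cert210,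
     (1458, [:: 6; 0; 3; 6; 6; 0],
      [:: 0; 0; 0; 0; 0; 0; 0; 108; 0; 0; 108; 0; 0; 270; 0; 0; 0; 144; 0; 36; 252; 0; 96; 48; 0; 240; 48; 108]));
    (map_cert true 0 cert210,
     (1458, [:: 0; 6; 3; 0; 0; 6],
      [:: 0; 0; 0; 0; 108; 0; 0; 0; 0; 0; 270; 0; 0; 108; 0; 144; 0; 0; 36; 0; 252; 48; 240; 0; 48; 96; 0; 108]));
    (map_cert true 1 cert210,
     (1458, [:: 3; 0; 6; 3; 3; 0],
      [:: 0; 0; 0; 0; 0; 0; 108; 0; 0; 108; 0; 0; 270; 0; 0; 0; 144; 0; 252; 36; 0; 96; 0; 48; 240; 0; 48; 108]));
    (map_cert true 2 cert210,
     (1458, [:: 6; 3; 0; 6; 6; 3],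
      [:: 0; 0; 0; 0; 0; 0; 0; 0; 108; 0; 0; 108; 0; 0; 270; 0; 0; 144; 0; 252; 36; 0; 48; 96; 0; 48; 240; 108]));
    (map_cert false 0 cert111,
     (486, [:: 0; 3; 6; 0; 3; 6],
      [:: 0; 0; 0; 0; 0; 0; 0; 0; 0; 0; 0; 0; 0; 0; 0; 24; 24; 24; 30; 30; 30; 40; 40; 40; 40; 40; 40; 84]))]%N.

Definition expansion_coef (e i : nat) : nat :=
  nth 0%N (nth ([::], (0%N, [::], [::])) expansions e).2.2 i.

Lemma expansions_certified : all (fun e => (size e.2.2 == 28%N)
  && certifies e.1 (expansion e.2.1.1 e.2.1.2 e.2.2)) expansions.
Proof. by vm_compute. Qed.

End Combinatorics.

(** * Soundness of the certificates at generic points *)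

Section Identities.
Context {R : realType}.
Variables p1 p2 p3 : R * R.
Local Notation D := (orient p1 p2 p3).
Hypothesis D0 : D != 0.

Definition knot (n : nat) : R * R := nth (0, 0)
  [:: p1; p31 p1 p2; p32 p1 p2; p2; p12 p2 p3; p13 p2 p3; p3; p23 p1 p3; p21 p1 p3] n.

Lemma knotE n : (n < 9)%N -> let: (a, b, c) := knot_weights n in
  [/\ (knot n).1 = (a%:~R * p1.1 + b%:~R * p2.1 + c%:~R * p3.1) / 3,
      (knot n).2 = (a%:~R * p1.2 + b%:~R * p2.2 + c%:~R * p3.2) / 3
    & a%:~R + b%:~R + c%:~R = 3 :> R].
Proof.
by case: n => [|[|[|[|[|[|[|[|[|//]]]]]]]]] _ /=; split; rewrite /=; field.
Qed.

(** Each of the three tripled weight vectors contributes a factor 3, hence 27. *)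
Lemma orient_knot a b c : (a < 9)%N -> (b < 9)%N -> (c < 9)%N ->
  orient (knot a) (knot b) (knot c) = (knot_det a b c)%:~R / 27 * D.
Proof.
move=> /knotE + /knotE + /knotE; rewrite /knot_det.
case: (knot_weights a) => [[a1 a2] a3]; case: (knot_weights b) => [[b1 b2] b3].
case: (knot_weights c) => [[c1 c2] c3] [A1 A2 A3] [B1 B2 B3] [C1 C2 C3].
rewrite !(intrD, mulrNz, intrM) /orient A1 A2 B1 B2 C1 C2.
have -> : a3%:~R = 3 - a1%:~R - a2%:~R :> R by rewrite -A3; ring.
have -> : b3%:~R = 3 - b1%:~R - b2%:~R :> R by rewrite -B3; ring.
have -> : c3%:~R = 3 - c1%:~R - c2%:~R :> R by rewrite -C3; ring.
by field.
Qed.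

Definition generic (x : R * R) : Prop := forall k l, (k < 9)%N -> (l < 9)%N -> k != l ->
  orient x (knot k) (knot l) != 0.

Definition knot_spline (x : R * R) (l : seq nat) : R :=
  simplex_spline (knots6 (map knot l)) x.

Definition eval_formal (x : R * R) (F : seq (int * seq nat)) : R :=
  \sum_(ck <- F) ck.1%:~R * knot_spline x ck.2.

(** Sorting picks one representative of each multiset, so that equal splines cancel syntactically in
    [formal_zero]. *)
Lemma knot_spline_sort x a b t u v w : (a < 9)%N -> (b < 9)%N -> (t < 9)%N ->
  knot_det a b t != 0 ->
  knot_spline x (sort leq [:: a; b; t; u; v; w]) =
  simplex_spline (knots6 [:: knot a; knot b; knot t; knot u; knot v; knot w]) x.
Proof.
move=> a9 b9 t9 Dt; apply: spline_perm.
  by rewrite orient_knot // !mulf_neq0 ?intr_eq0 // invr_eq0 pnatr_eq0.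
by rewrite (_ : [:: _; _; _; _; _; _] = map knot [:: a; b; t; u; v; w]) // perm_map // perm_sort.
Qed.

Lemma eval_insertion_rel x e : generic x -> eval_formal x (insertion_rel e) = 0.
Proof.
move=> gx; case: e => c [|a [|b [|k [|na [|nb [|t [|u [|v [|w [|]]]]]]]]]];
  rewrite /eval_formal /insertion_rel /= ?big_nil //.
case: ifPn => [|_]; last by rewrite big_nil.
move=> /and4P[/and4P[a9 b9 k9 /and4P[t9 _ _ _]] kt Dabt seg].
move: (knotE a9) (knotE b9) (knotE k9) seg (orient_knot k9 b9 t9) (orient_knot a9 k9 t9).
rewrite !big_cons big_nil /= knot_spline_sort // /on_segment {1 2}/knot_det.
move Da : (knot_weights a) => wa; case: wa Da => [[a1 a2] a3] Da [A1 A2 A3].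
move Db : (knot_weights b) => wb; case: wb Db => [[b1 b2] b3] Db [B1 B2 B3].
move Dk : (knot_weights k) => wk; case: wk Dk => [[k1 k2] k3] Dk [K1 K2 K3].
move=> /and5P[na0 nb0 /eqP e1 /eqP e2 /eqP e3] _ _.
have m0 : (na + nb)%:R != 0 :> R by rewrite pnatr_eq0 addn_eq0 negb_and -!lt0n na0.
have E (y1 y2 y3 : int) : (na + nb)%:Z * y1 = na%:Z * y2 + nb%:Z * y3 ->
    (na%:R + nb%:R) * y1%:~R = na%:R * y2%:~R + nb%:R * y3%:~R :> R.
  by move=> /(congr1 (fun i : int => i%:~R : R)); rewrite !(intrD, intrM) /= -!pmulrn natrD.
have F1 := E _ _ _ e1; have F2 := E _ _ _ e2; have F3 := E _ _ _ e3.
pose al : R := na%:R / (na + nb)%:R; pose be : R := nb%:R / (na + nb)%:R.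
have kE : knot k = (al * (knot a).1 + be * (knot b).1, al * (knot a).2 + be * (knot b).2).
  transitivity ((knot k).1, (knot k).2); first by case: (knot k).
  have m0' : na%:R + nb%:R != 0 :> R by rewrite -natrD.
  have dv (y z : R) : (na%:R + nb%:R) * y = z -> y = z / (na%:R + nb%:R).
    by move=> <-; field.
  rewrite A1 A2 B1 B2 K1 K2 (dv _ _ F1) (dv _ _ F2) (dv _ _ F3) /al /be natrD.
  by congr (_, _); field.
have oabt : orient (knot a) (knot b) (knot t) != 0.
  by rewrite orient_knot // !mulf_neq0 ?intr_eq0 // invr_eq0 pnatr_eq0.
have nz : (na + nb)%:Z != 0 by rewrite eqz_nat addn_eq0 negb_and -!lt0n na0.
have al0 : 0 < al by rewrite divr_gt0 ?ltr0n // addn_gt0 na0.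
have be0 : 0 < be by rewrite divr_gt0 ?ltr0n // addn_gt0 na0.
have albe : al + be = 1 by rewrite /al /be -mulrDl -natrD divff.
(* Insertion multiplies the determinant of the leading triple by [al] or [be], so both new lists
   again start with affinely independent knots and may be sorted. *)
have ck : orient (knot k) (knot b) (knot t) = al * orient (knot a) (knot b) (knot t).
  rewrite kE /orient /= (_ : al = 1 - be); first by ring.
  by rewrite -albe; ring.
have cl : orient (knot a) (knot k) (knot t) = be * orient (knot a) (knot b) (knot t).
  rewrite kE /orient /= (_ : be = 1 - al); first by ring.
  by rewrite -albe; ring.
have nzk : knot_det k b t != 0.
  apply: contraTneq isT => z; move: (mulf_neq0 (lt0r_neq0 al0) oabt).
  by rewrite -ck orient_knot // z mul0r mul0r eqxx.
have nzl : knot_det a k t != 0.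
  apply: contraTneq isT => z; move: (mulf_neq0 (lt0r_neq0 be0) oabt).
  by rewrite -cl orient_knot // z mul0r mul0r eqxx.
rewrite !knot_spline_sort //.
rewrite (spline_insert (knot u) (knot v) (knot w) oabt al0 be0 albe kE (gx _ _ k9 t9 kt)).
rewrite !(intrD, mulrNz, intrM) -!pmulrn /al /be.
move: (simplex_spline (knots6 (knot k :: _)) x) (simplex_spline (knots6 (knot a :: _)) x).
by move: m0; rewrite natrD; clear; move=> m0 M1 M2; field.
Qed.

Lemma eval_formal_zero x n F : formal_zero n F -> eval_formal x F = 0.
Proof.
elim: n F => [|n IH] [|[c k] F] //=; rewrite /eval_formal ?big_nil // => /andP[/eqP s0 /IH].
rewrite eqxx /= /eval_formal big_filter => H.
rewrite (bigID (fun ck : int * seq nat => ck.2 == k)) /= [X in _ + X](_ : _ = 0); last first.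
  by rewrite big_cons /= eqxx.
rewrite addr0 big_cons /= eqxx.
rewrite (eq_bigr (fun ck : int * seq nat => ck.1%:~R * knot_spline x k)); last by move=> ck /eqP ->.
rewrite -mulr_suml -mulrDl; move: s0; rewrite eqxx => s0.
suff -> : \sum_(ck <- F | ck.2 == k) ck.1%:~R
    = (foldr (fun dk s => if dk.2 == k then dk.1 + s else s) 0 F)%:~R :> R.
  by rewrite -intrD s0 mul0r.
elim: F {H s0} => [|[d l] F IHF]; first by rewrite big_nil.
by rewrite big_cons /= IHF; case: eqP; rewrite ?intrD.
Qed.

Lemma certifiesP x cert target : generic x -> certifies cert target ->
  eval_formal x target = 0.
Proof.
move=> gx /(eval_formal_zero x); rewrite /eval_formal big_cat /=.
rewrite [X in _ + X](_ : _ = - \sum_(e <- cert) eval_formal x (insertion_rel e)).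
  by rewrite [X in _ - X]big1 ?subr0 // => e _; exact: eval_insertion_rel.
rewrite /opp_formal big_map (eq_bigr (fun ck => - (ck.1%:~R * knot_spline x ck.2))); last first.
  by move=> ck _; rewrite /= rmorphN mulNr.
by rewrite sumrN big_flatten big_map.
Qed.

Definition basis_spline (x : R * R) (i : nat) : R :=
  knot_spline x (sort leq (nth [::] knot_lists i)).

Lemma eval_expansion x N b c : size c = 28%N -> eval_formal x (expansion N b c)
  = N%:R * knot_spline x (sort leq b)
    - \sum_(0 <= i < 28) (nth 0%N c i)%:R * basis_spline x i.
Proof.
move=> sc; rewrite /eval_formal big_cons big_map -pmulrn; congr (_ + _).
rewrite (big_nth (0%N, [::])) size_zip sc -sumrN; apply: eq_bigr => i _.
by rewrite nth_zip // mulrNz -pmulrn mulNr.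
Qed.

Lemma expansionsP x e N b : generic x -> (e < 10)%N ->
  (nth ([::], (0%N, [::], [::])) expansions e).2.1 = (N, b) ->
  N%:R * knot_spline x (sort leq b)
  = \sum_(0 <= i < 28) (expansion_coef e i)%:R * basis_spline x i.
Proof.
move=> gx e10; rewrite /expansion_coef.
have := all_nthP ([::], (0%N, [::], [::])) expansions_certified e e10.
case: (nth _ _ _) => cert [[N' b'] c] /= /andP[/eqP sc /(certifiesP gx)] + [<- <-].
by rewrite eval_expansion // => /eqP; rewrite subr_eq0 => /eqP.
Qed.

End Identities.

(** * Bernstein polynomials as simplex splines with knots at the vertices *)

Section Bernstein.
Context {R : realType}.
Local Notation mR := (measurableTypeR R).

Lemma bc_vertices (r s t : R * R) : orient r s t != 0 ->
  [/\ bc1 r s t r = 1, bc1 r s t s = 0 & bc1 r s t t = 0] /\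
  [/\ bc2 r s t r = 0, bc2 r s t s = 1 & bc2 r s t t = 0] /\
  [/\ bc3 r s t r = 0, bc3 r s t s = 0 & bc3 r s t t = 1].
Proof.
by rewrite /bc1 /bc2 /bc3 /orient => D; split; [|split]; split; field.
Qed.

Lemma vol3X (A : set (mR * mR)) (C : set mR) : measurable A -> measurable C ->
  vol3 (A `*` C) = (leb2 A * lebesgue_measure C)%E.
Proof. by move=> mA mC; rewrite -leb3E /leb3 product_measure1E. Qed.

(** With [r] as each free knot only the face of [r] constrains: the fiber is a tetrahedron of size
    [bc1], and 20 = 120 / 3!. *)
Lemma bernstein3 (r s t x : R * R) : orient r s t != 0 ->
  0 <= bc1 r s t x -> 0 <= bc2 r s t x -> 0 <= bc3 r s t x ->
  simplex_spline (knots6 [:: r; s; t; r; r; r]) x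
  = 20 / `|orient r s t| * bc1 r s t x ^+ 3.
Proof.
move=> D x1 x2 x3; rewrite spline_eval //.
have [[a1 a2 a3] [[b1 b2 b3] [c1 c2 c3]]] := bc_vertices D.
rewrite (_ : fiber _ _ _ _ _ _ _ = [set q | [/\ 0 <= q.1.1, 0 <= q.1.2, 0 <= q.2
  & q.1.1 + q.1.2 + q.2 <= bc1 r s t x]]).
  rewrite vol3_simplex /spow (max_idPl x1) /=.
  have d0 : `|orient r s t| != 0 by rewrite normr_eq0.
  have -> : (3`!)%:R = 6 :> R by [].
  by field; exact: d0.
apply/seteqP; split=> q; rewrite /fiber /lin3 /nv /= a1 b1 c1 !mul1r !mul0r !addr0.
  by move=> [[? ? ?] [? ? ?]].
by move=> [? ? ? ?].
Qed.

(** The fiber is a prism, a triangle of size [bc1] times an interval of length [bc2], and 60 = 120 /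
    2!. *)
Lemma bernstein21 (r s t x : R * R) : orient r s t != 0 ->
  0 <= bc1 r s t x -> 0 <= bc2 r s t x -> 0 <= bc3 r s t x ->
  simplex_spline (knots6 [:: r; s; t; r; r; s]) x
  = 60 / `|orient r s t| * (bc1 r s t x ^+ 2 * bc2 r s t x).
Proof.
move=> D x1 x2 x3; rewrite spline_eval //.
have [[a1 a2 a3] [[b1 b2 b3] [c1 c2 c3]]] := bc_vertices D.
rewrite (_ : fiber _ _ _ _ _ _ _ = [set p : mR * mR | [/\ 0 <= p.1, 0 <= p.2
  & p.1 + p.2 <= bc1 r s t x]] `*` [set` `[0, bc2 r s t x]]).
  rewrite vol3X; last 2 first.
  - rewrite (_ : [set p | _] = [set p : mR * mR | (0 : R) <= p.1] `&` [set p : mR * mR | (0 : R) <= p.2]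
      `&` [set p : mR * mR | (p.1 + p.2 : R) <= bc1 r s t x]).
      apply: measurableI; first apply: measurableI; apply: measurable_le => //.
      exact: measurable_funD.
    by apply/seteqP; split=> p /=; [case|case; case].
  - exact: measurable_itv.
  rewrite area_simplex lebesgue_measure_itv /= lte_fin /spow (max_idPl x1).
  have d0 : `|orient r s t| != 0 by rewrite normr_eq0.
  have -> : (2`!)%:R = 2 :> R by [].
  have [_|x20] := ltP 0 (bc2 r s t x).
    by rewrite -EFinB subr0 -EFinM /=; field; exact: d0.
  have -> : bc2 r s t x = 0 by apply/le_anti; rewrite x20.
  by rewrite mule0 /= !mulr0.
apply/seteqP; split=> q; rewrite /fiber /lin3 /nv /= a1 a2 b1 b2 c1 c2 !mul1r !mul0r ?in_itv /=.
  by move=> [[q1 q2 q3] [h1 h2 h3]]; split; [split|]; rewrite ?in_itv /=; lra.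
by move=> [[q1 q2 h1] /andP[q3 h2]]; split; split; lra.
Qed.

Lemma bernstein111 (r s t x : R * R) : orient r s t != 0 ->
  0 <= bc1 r s t x -> 0 <= bc2 r s t x -> 0 <= bc3 r s t x ->
  simplex_spline (knots6 [:: r; s; t; r; s; t]) x
  = 120 / `|orient r s t| * (bc1 r s t x * bc2 r s t x * bc3 r s t x).
Proof.
move=> D x1 x2 x3; rewrite spline_eval //.
have [[a1 a2 a3] [[b1 b2 b3] [c1 c2 c3]]] := bc_vertices D.
have I (h : R) : 0 <= h -> leb ([set` `[0, h]] : set mR) = h%:E.
  rewrite le_eqVlt => /predU1P[<-|h0].
    by rewrite /leb lebesgue_measure_itv /= ltxx.
  by rewrite /leb lebesgue_measure_itv /= lte_fin h0 -EFinB subr0.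
rewrite (_ : fiber _ _ _ _ _ _ _ = ([set` `[0, bc1 r s t x]] `*` [set` `[0, bc2 r s t x]])
  `*` [set` `[0, bc3 r s t x]]).
  by rewrite vol3_box ?I //; exact: measurable_itv.
apply/seteqP; split=> q; rewrite /fiber /lin3 /nv /= a1 a2 a3 b1 b2 b3 c1 c2 c3
    !mul1r !mul0r !in_itv /=.
  by move=> [[q1 q2 q3] [h1 h2 h3]]; split; [split|]; rewrite ?in_itv /=; lra.
by move=> [[/andP[q1 h1] /andP[q2 h2]] /andP[q3 h3]]; split; split; lra.
Qed.

End Bernstein.

(** * Orders of the knots suited to continuity *)

Section Arrangements.
Local Open Scope int_scope.

(** The coordinate has value [f k / D] at knot [k]; multiplying by [D] tests its sign without
    division, and by affinity the vertices 0, 3, 6 decide nonnegativity on the triangle. *)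
Definition coordinate_ok (D : int) (f : nat -> int) (l : seq nat) : bool :=
  has (fun k => f k != 0) l || all (fun k => 0 <= f k * D)%R [:: 0; 3; 6]%N.

Definition arrangement_ok (l a : seq nat) : bool :=
  if a is [:: r; s; t; u; v; w] then
    let D := knot_det r s t in
    [&& all (fun k => k < 9)%N a, D != 0, perm_eq l a,
        coordinate_ok D (fun k => knot_det k s t) [:: u; v; w],
        coordinate_ok D (fun k => knot_det r k t) [:: u; v; w]
      & coordinate_ok D (fun k => knot_det r s k) [:: u; v; w]]
  else false.

Lemma knot_arrangements_ok i : (i < 28)%N ->
  arrangement_ok (nth [::] knot_lists i) (nth [::] knot_arrangements i).
Proof.
have /allP H : all (fun i => arrangement_ok (nth [::] knot_lists i) (nth [::] knot_arrangements i))
    (iota 0 28) by vm_compute.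
by move=> i28; apply: H; rewrite mem_iota.
Qed.

End Arrangements.

Lemma perm_sort_leq (l l' : seq nat) : perm_eq l l' -> sort leq l = sort leq l'.
Proof. by move/(perm_sortP leq_total leq_trans anti_leq). Qed.

(** * The identity at generic points of the triangle *)

Section Marsden.
Context {R : realType}.
Variables p1 p2 p3 : R * R.
Local Notation D := (orient p1 p2 p3).
Hypothesis D0 : D != 0.

Lemma nth_Xis i : (i < 28)%N ->
  nth [::] (Xis p1 p2 p3) i = map (knot p1 p2 p3) (nth [::] knot_lists i).
Proof. by do 28 (case: i => [//|i]). Qed.

Lemma arrangement_okP l a : arrangement_ok l a ->
  exists r s t u v w, [/\ a = [:: r; s; t; u; v; w],
    orient (knot p1 p2 p3 r) (knot p1 p2 p3 s) (knot p1 p2 p3 t) != 0,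
    [&& (r < 9)%N, (s < 9)%N, (t < 9)%N & knot_det r s t != 0] & perm_eq l a].
Proof.
case: a => [|r [|s [|t [|u [|v [|w [|]]]]]]] //= /and5P[/and4P[r9 s9 t9 _] rst P _ _].
exists r, s, t, u, v, w; split=> //; last by rewrite r9 s9 t9.
by rewrite orient_knot // !mulf_neq0 ?intr_eq0 // invr_eq0 pnatr_eq0.
Qed.

Lemma spline_arrangement x l a : arrangement_ok l a ->
  simplex_spline (knots6 (map (knot p1 p2 p3) l)) x
  = simplex_spline (knots6 (map (knot p1 p2 p3) a)) x.
Proof.
move=> /arrangement_okP[r [s [t [u [v [w [-> D' _ P]]]]]]].
exact: (spline_perm _ D' (perm_map _ P)).
Qed.

Lemma knot_spline_arrangement x l a : arrangement_ok l a ->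
  simplex_spline (knots6 (map (knot p1 p2 p3) l)) x = knot_spline p1 p2 p3 x (sort leq l).
Proof.
move=> H; rewrite (spline_arrangement x H).
case/arrangement_okP: H => [r [s [t [u [v [w [-> D' /and4P[r9 s9 t9 rst] P]]]]]]].
by rewrite (perm_sort_leq P) knot_spline_sort.
Qed.

Lemma spline_Xis x i : (i < 28)%N -> simplex_spline (knots6 (nth [::] (Xis p1 p2 p3) i)) x
  = knot_spline p1 p2 p3 x (sort leq (nth [::] knot_lists i)).
Proof.
move=> i28; rewrite (nth_Xis i28).
exact: (knot_spline_arrangement _ (knot_arrangements_ok i28)).
Qed.

Lemma bernstein_knots x (a b c : nat) (r := knot p1 p2 p3 a) (s := knot p1 p2 p3 b)
    (t := knot p1 p2 p3 c) : (a < 9)%N -> (b < 9)%N -> (c < 9)%N -> knot_det a b c != 0 ->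
  0 <= bc1 r s t x -> 0 <= bc2 r s t x -> 0 <= bc3 r s t x ->
  [/\ knot_spline p1 p2 p3 x (sort leq [:: a; b; c; a; a; a])
      = 20 / `|orient r s t| * bc1 r s t x ^+ 3,
      knot_spline p1 p2 p3 x (sort leq [:: a; b; c; a; a; b])
      = 60 / `|orient r s t| * (bc1 r s t x ^+ 2 * bc2 r s t x)
    & knot_spline p1 p2 p3 x (sort leq [:: a; b; c; a; b; c])
      = 120 / `|orient r s t| * (bc1 r s t x * bc2 r s t x * bc3 r s t x)].
Proof.
move=> a9 b9 c9 abc x1 x2 x3.
have D' : orient r s t != 0.
  by rewrite orient_knot // !mulf_neq0 ?intr_eq0 // invr_eq0 pnatr_eq0.
by rewrite !knot_spline_sort //; split; [exact: bernstein3|exact: bernstein21|exact: bernstein111].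
Qed.

Lemma bc_cycle (r s t y : R * R) : [/\ bc1 s t r y = bc2 r s t y, bc2 s t r y = bc3 r s t y
  & bc3 s t r y = bc1 r s t y].
Proof.
have E : orient s t r = orient r s t by rewrite /orient; ring.
by rewrite /bc1 /bc2 /bc3 E; split; congr (_ / _); rewrite /orient; ring.
Qed.

Lemma bc_swap (r s t y : R * R) : [/\ bc1 s r t y = bc2 r s t y, bc2 s r t y = bc1 r s t y
  & bc3 s r t y = bc3 r s t y].
Proof.
have E : orient s r t = - orient r s t by rewrite /orient; ring.
by rewrite /bc1 /bc2 /bc3 E; split; rewrite invrN mulrN -mulNr; congr (_ / _);
  rewrite /orient; ring.
Qed.

(** This comparison determines the entries of [expansions]: [c_i] times the coefficient of the
    monomial in [psi_i], times 972 for a square times a linear form and 324 otherwise. The 30 comes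
    from [wt] with area [|D| / 2]; 20, 60, 120 are the Bernstein normalizations. *)
Lemma psi_expansion (y : R * R) i (l1 := ell p1 y) (l2 := ell p2 y) (l3 := ell p3 y) :
  (i < 28)%N -> psi p1 p2 p3 i y * (nth 0 cs i / 30) =
  (l1 ^+ 3) * (1 / (20 * 486) * (expansion_coef 0 i)%:R)
    + (l2 ^+ 3) * (1 / (20 * 486) * (expansion_coef 1 i)%:R)
    + (l3 ^+ 3) * (1 / (20 * 486) * (expansion_coef 2 i)%:R)
    + 3 * (l1 ^+ 2 * l2) * (1 / (60 * 1458) * (expansion_coef 3 i)%:R)
    + 3 * (l2 ^+ 2 * l3) * (1 / (60 * 1458) * (expansion_coef 4 i)%:R)
    + 3 * (l3 ^+ 2 * l1) * (1 / (60 * 1458) * (expansion_coef 5 i)%:R)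
    + 3 * (l1 ^+ 2 * l3) * (1 / (60 * 1458) * (expansion_coef 6 i)%:R)
    + 3 * (l2 ^+ 2 * l1) * (1 / (60 * 1458) * (expansion_coef 7 i)%:R)
    + 3 * (l3 ^+ 2 * l2) * (1 / (60 * 1458) * (expansion_coef 8 i)%:R)
    + 6 * (l1 * l2 * l3) * (1 / (120 * 486) * (expansion_coef 9 i)%:R).
Proof.
have E1 : ell p1 y = l1 by []. have E2 : ell p2 y = l2 by []. have E3 : ell p3 y = l3 by [].
have e31 : ell (p31 p1 p2) y = 2 / 3 * l1 + 1 / 3 * l2 by rewrite /l1 /l2 /ell /dot /=; field.
have e32 : ell (p32 p1 p2) y = 1 / 3 * l1 + 2 / 3 * l2 by rewrite /l1 /l2 /ell /dot /=; field.
have e12 : ell (p12 p2 p3) y = 2 / 3 * l2 + 1 / 3 * l3 by rewrite /l2 /l3 /ell /dot /=; field.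
have e13 : ell (p13 p2 p3) y = 1 / 3 * l2 + 2 / 3 * l3 by rewrite /l2 /l3 /ell /dot /=; field.
have e21 : ell (p21 p1 p3) y = 2 / 3 * l1 + 1 / 3 * l3 by rewrite /l1 /l3 /ell /dot /=; field.
have e23 : ell (p23 p1 p3) y = 1 / 3 * l1 + 2 / 3 * l3 by rewrite /l1 /l3 /ell /dot /=; field.
have em1 : ell (m1 p1 p2 p3) y = 2 / 5 * l1 + 2 / 5 * l2 + 1 / 5 * l3.
  by rewrite /l1 /l2 /l3 /ell /dot /=; field.
have em2 : ell (m2 p1 p2 p3) y = 1 / 5 * l1 + 2 / 5 * l2 + 2 / 5 * l3.
  by rewrite /l1 /l2 /l3 /ell /dot /=; field.
have em3 : ell (m3 p1 p2 p3) y = 2 / 5 * l1 + 1 / 5 * l2 + 2 / 5 * l3.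
  by rewrite /l1 /l2 /l3 /ell /dot /=; field.
have eqc : ell (qc p1 p2 p3) y = 1 / 3 * l1 + 1 / 3 * l2 + 1 / 3 * l3.
  by rewrite /l1 /l2 /l3 /ell /dot /=; field.
move: l1 l2 l3 E1 E2 E3 e31 e32 e12 e13 e21 e23 em1 em2 em3 eqc.
move=> l1 l2 l3 E1 E2 E3 e31 e32 e12 e13 e21 e23 em1 em2 em3 eqc; rewrite /psi.
by do 28 (case: i => [|i]; first by move=> _; rewrite /expansion_coef /=
  ?e31 ?e32 ?e12 ?e13 ?e21 ?e23 ?em1 ?em2 ?em3 ?eqc ?E1 ?E2 ?E3; field).
Qed.

Lemma marsden_generic x y : generic p1 p2 p3 x ->
  0 <= bc1 p1 p2 p3 x -> 0 <= bc2 p1 p2 p3 x -> 0 <= bc3 p1 p2 p3 x ->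
  (1 + dot y x) ^+ 3 = \sum_(i < 28) psi p1 p2 p3 i y *
    (wt p1 p2 p3 i * simplex_spline (knots6 (nth [::] (Xis p1 p2 p3) i)) x).
Proof.
move=> gx.
set X1 := bc1 p1 p2 p3 x; set X2 := bc2 p1 p2 p3 x; set X3 := bc3 p1 p2 p3 x => x1 x2 x3.
pose d : R := `|D|; have d0 : d != 0 by rewrite normr_eq0.
pose l1 := ell p1 y; pose l2 := ell p2 y; pose l3 := ell p3 y.
pose t := basis_spline p1 p2 p3 x.
(* Barycentric coordinates sum to 1, so the constant term distributes over the vertices. *)
have LHS : 1 + dot y x = l1 * X1 + l2 * X2 + l3 * X3.
  rewrite /l1 /l2 /l3 /X1 /X2 /X3 /ell /dot /bc1 /bc2 /bc3.
  by move: D0; rewrite /orient => ?; field.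
rewrite LHS -(big_mkord xpredT (fun i => psi p1 p2 p3 i y *
    (wt p1 p2 p3 i * simplex_spline (knots6 (nth [::] (Xis p1 p2 p3) i)) x))).
rewrite (eq_big_nat _ _ (F2 := fun i => psi p1 p2 p3 i y * (d / 30 * nth 0 cs i) * t i)); last first.
  by move=> i /andP[_ i28]; rewrite (spline_Xis _ i28) mulrA /wt /tri_area -/D -/d /t; congr (_ * _ * _); field.
have eD (a b c : R * R) : orient b c a = orient a b c by rewrite /orient; ring.
have eN (a b c : R * R) : `|orient b a c| = `|orient a b c|.
  by rewrite -normrN; congr (`|_|); rewrite /orient; ring.
have d123 : `|orient p2 p3 p1| = d by rewrite eD.
have d231 : `|orient p3 p1 p2| = d by rewrite eD eD.
have d213 : `|orient p2 p1 p3| = d by rewrite eN.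
have d132 : `|orient p1 p3 p2| = d by rewrite eN d231.
have d321 : `|orient p3 p2 p1| = d by rewrite eN d123.
have [c1 c2 c3] := bc_cycle p1 p2 p3 x; have [e1 e2 e3] := bc_cycle p2 p3 p1 x.
have [f1 f2 f3] := bc_swap p1 p2 p3 x; have [g1 g2 g3] := bc_swap p3 p1 p2 x.
have [h1 h2 h3] := bc_swap p2 p3 p1 x.
rewrite -/X1 -/X2 -/X3 in c1 c2 c3 f1 f2 f3.
rewrite c1 c2 c3 in e1 e2 e3 h1 h2 h3; rewrite e1 e2 e3 in g1 g2 g3.
have := @bernstein_knots x 0 3 6 isT isT isT isT x1 x2 x3.
rewrite -/X1 -/X2 -/X3 -/d => -[b300 b210 b111].
have := @bernstein_knots x 3 6 0 isT isT isT isT; rewrite /= d123 c1 c2 c3.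
move=> /(_ x2 x3 x1)[b030 b021 _].
have := @bernstein_knots x 6 0 3 isT isT isT isT; rewrite /= d231 e1 e2 e3.
move=> /(_ x3 x1 x2)[b003 b102 _].
have := @bernstein_knots x 3 0 6 isT isT isT isT; rewrite /= d213 f1 f2 f3.
move=> /(_ x2 x1 x3)[_ b120 _].
have := @bernstein_knots x 0 6 3 isT isT isT isT; rewrite /= d132 g1 g2 g3.
move=> /(_ x1 x3 x2)[_ b201 _].
have := @bernstein_knots x 6 3 0 isT isT isT isT; rewrite /= d321 h1 h2 h3.
move=> /(_ x3 x2 x1)[_ b012 _].
(* The factor is written as a successor to be visibly nonzero, hence 485 and 1457 below for 486 and
   1458. *)
have sol (N : nat) (k X S : R) : N.+1%:R * (k / d * X) = S -> k != 0 -> X = d / (k * N.+1%:R) * S.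
  have N0 : N.+1%:R != 0 :> R by rewrite pnatr_eq0.
  by move=> <- k0; field; rewrite k0 d0 addrC natr1 N0.
have n20 : 20 != 0 :> R by rewrite pnatr_eq0.
have n60 : 60 != 0 :> R by rewrite pnatr_eq0.
have n120 : 120 != 0 :> R by rewrite pnatr_eq0.
have H e N b := @expansionsP _ p1 p2 p3 D0 x e N b gx.
have := H 0%N 486%N [:: 0; 3; 6; 0; 0; 0]%N isT erefl; rewrite b300 => /(@sol 485) - /(_ n20) S300.
have := H 1%N 486%N [:: 3; 0; 6; 3; 3; 3]%N isT erefl; rewrite b030 => /(@sol 485) - /(_ n20) S030.
have := H 2%N 486%N [:: 6; 0; 3; 6; 6; 6]%N isT erefl; rewrite b003 => /(@sol 485) - /(_ n20) S003.
have := H 3%N 1458%N [:: 0; 3; 6; 0; 0; 3]%N isT erefl; rewrite b210 => /(@sol 1457) - /(_ n60) S210.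
have := H 4%N 1458%N [:: 3; 6; 0; 3; 3; 6]%N isT erefl; rewrite b021 => /(@sol 1457) - /(_ n60) S021.
have := H 5%N 1458%N [:: 6; 0; 3; 6; 6; 0]%N isT erefl; rewrite b102 => /(@sol 1457) - /(_ n60) S102.
have := H 6%N 1458%N [:: 0; 6; 3; 0; 0; 6]%N isT erefl; rewrite b201 => /(@sol 1457) - /(_ n60) S201.
have := H 7%N 1458%N [:: 3; 0; 6; 3; 3; 0]%N isT erefl; rewrite b120 => /(@sol 1457) - /(_ n60) S120.
have := H 8%N 1458%N [:: 6; 3; 0; 6; 6; 3]%N isT erefl; rewrite b012 => /(@sol 1457) - /(_ n60) S012.
have := H 9%N 486%N [:: 0; 3; 6; 0; 3; 6]%N isT erefl; rewrite b111 => /(@sol 485) - /(_ n120) S111.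
rewrite (_ : (_ + _ + _) ^+ 3 =
    (l1 ^+ 3) * (X1 ^+ 3) + (l2 ^+ 3) * (X2 ^+ 3) + (l3 ^+ 3) * (X3 ^+ 3)
    + (3 * (l1 ^+ 2 * l2)) * (X1 ^+ 2 * X2) + (3 * (l2 ^+ 2 * l3)) * (X2 ^+ 2 * X3)
    + (3 * (l3 ^+ 2 * l1)) * (X3 ^+ 2 * X1) + (3 * (l1 ^+ 2 * l3)) * (X1 ^+ 2 * X3)
    + (3 * (l2 ^+ 2 * l1)) * (X2 ^+ 2 * X1) + (3 * (l3 ^+ 2 * l2)) * (X3 ^+ 2 * X2)
    + (6 * (l1 * l2 * l3)) * (X1 * X2 * X3)); last by ring.
rewrite S300 S030 S003 S210 S021 S102 S201 S120 S012 S111.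
rewrite !mulr_sumr -!big_split /=; apply: eq_big_nat => i /andP[_ i28].
rewrite [psi _ _ _ _ _ * _](_ : _ = d * (psi p1 p2 p3 i y * (nth 0 cs i / 30))); last by ring.
rewrite psi_expansion // -/(t i) -/l1 -/l2 -/l3.
by move: (t i) (expansion_coef) => T C; field.
Qed.

End Marsden.

(** * Lipschitz dependence of polytope volumes on face offsets *)

Section Continuity.
Context {R : realType}.
Local Notation mR := (measurableTypeR R).
Local Notation T3 := ((mR * mR) * mR)%type.

Definition affine_fun (f : R * R -> R) : Prop :=
  exists a b c : R, forall x, f x = a * x.1 + b * x.2 + c.

Lemma affine_continuous (f : R * R -> R) : affine_fun f -> continuous f.
Proof.
move=> [a [b [c fE]]]; rewrite (_ : f = fun x => a * x.1 + b * x.2 + c); last exact/funext.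
move=> x; apply: cvgD; last exact: cvg_cst.
by apply: cvgD; apply: cvgM; [exact: cvg_cst|exact: cvg_fst|exact: cvg_cst|exact: cvg_snd].
Qed.

Lemma orient_affine (s t : R * R) : affine_fun (fun x => orient x s t).
Proof.
exists (s.2 - t.2), (t.1 - s.1), (s.1 * t.2 - t.1 * s.2) => x; rewrite /orient; ring.
Qed.

Lemma bc_affine (r s t : R * R) :
  [/\ affine_fun (bc1 r s t), affine_fun (bc2 r s t) & affine_fun (bc3 r s t)].
Proof.
have scale (f : R * R -> R) k : affine_fun f -> affine_fun (fun x => f x / k).
  by move=> [a [b [c fE]]]; exists (a / k), (b / k), (c / k) => x; rewrite fE; ring.
split; apply: scale; first exact: orient_affine.
- have [a [b [c H]]] := orient_affine t r; exists a, b, c => x.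
  by rewrite -H /orient; ring.
- have [a [b [c H]]] := orient_affine r s; exists a, b, c => x.
  by rewrite -H /orient; ring.
Qed.

(** For [n = 0] the half-space would jump from empty to everything as [e] crosses 0; dropping the
    constraint there removes the discontinuity. *)
Definition slab (n : (R * R) * R) (e : R) : set T3 := [set q | n = 0 \/ lin3 n q <= e].

Lemma measurable_slab n e : measurable (slab n e).
Proof.
have [n0|n0] := pselect (n = 0).
  by rewrite (_ : slab n e = setT) //; apply/seteqP; split=> // q _; left.
have ml := measurable_lin3 n 0.
rewrite (_ : slab n e = [set q | (lin3 n q + 0 : R) <= e]); last first.
  by apply/seteqP; split=> q; rewrite /slab /= addr0; [case|right].
exact: measurable_le.
Qed.

(** Translating a face changes the set only inside a strip of the cube. The constant depends on the
    normal alone, uniformly in the remaining polytope [F]. *)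
Lemma slab_lipschitz n : exists2 C : R, 0 <= C & forall (F : set T3) (e e' : R),
  measurable F -> F `<=` cube ->
  `|fine (vol3 (F `&` slab n e)) - fine (vol3 (F `&` slab n e'))| <= C * `|e - e'|.
Proof.
have [n0|n0] := eqVneq n 0.
  exists 0 => // F e e' _ _; rewrite (_ : slab n e = slab n e') ?subrr ?normr0 ?mul0r//.
  by apply/seteqP; split=> q _; left.
have [C C0 HC] := strip_vol3 n0; exists C => // F e e' mF FC.
wlog ee' : e e' / e <= e'.
  move=> H; have [|/ltW] := leP e e'; first exact: H.
  by move=> /H; rewrite distrC (distrC e).
have fin A : A `<=` F -> vol3 A \is a fin_num.
  by move=> AF; apply: fin_vol3 => q /AF /FC.
have f1 : vol3 (F `&` slab n e) \is a fin_num by apply: fin => q [].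
have f2 : vol3 (F `&` slab n e') \is a fin_num by apply: fin => q [].
have l1 : fine (vol3 (F `&` slab n e)) <= fine (vol3 (F `&` slab n e')).
  apply: fine_le => //; apply: le_vol3 => q [Fq [n0'|h]]; first by rewrite n0' eqxx in n0.
  by split=> //; right; exact: le_trans h ee'.
rewrite distrC ger0_norm ?subr_ge0// distrC ger0_norm ?subr_ge0// lerBlDl.
rewrite -lee_fin EFinD !fineK //.
apply: le_trans (_ : (vol3 (F `&` slab n e) + vol3 (cube `&` [set q | e <= lin3 n q <= e']%R) <= _)%E).
  apply: (@le_trans _ _ (vol3 ((F `&` slab n e) `|` (cube `&` [set q | e <= lin3 n q <= e']%R)))).
    apply: le_vol3 => q [Fq [n0'|h]]; first by rewrite n0' eqxx in n0.
    have [h'|h'] := leP (lin3 n q) e; [left|right]; split; rewrite //=; first by right.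
      exact: FC.
    by rewrite (ltW h').
  have -> : (cube `&` [set q | e <= lin3 n q <= e']%R : set T3) =
      (cube `&` [set q | e <= lin3 n q + 0]%R) `&` [set q | lin3 n q + 0 <= e']%R.
    apply/seteqP; split=> q /=; rewrite addr0; first by move=> [? /andP[]].
    by move=> [[? ->] ->].
  have ml := measurable_lin3 n 0.
  have mc : measurable (cube : set T3).
    by do 2 apply: measurableX => //; exact: measurable_itv.
  rewrite -leb3E; apply: measureU2.
    by apply: measurableI => //; exact: measurable_slab.
  by do 2 (apply: measurableI; last exact: measurable_le).
by apply: leeD => //; exact: HC.
Qed.

(** Intersecting with the cube keeps the volume finite when constraints are dropped. *)
Definition clipped_volume (n1 n2 n3 : (R * R) * R) (e1 e2 e3 : R) : R :=
  fine (vol3 (cube `&` [set q | [/\ 0 <= q.1.1, 0 <= q.1.2 & 0 <= q.2]]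
    `&` slab n1 e1 `&` slab n2 e2 `&` slab n3 e3)).

(** The faces move one at a time, the other two being absorbed into [F]. *)
Lemma clipped_volume_lipschitz n1 n2 n3 : exists C1 C2 C3 : R,
  forall e1 e2 e3 e1' e2' e3',
  `|clipped_volume n1 n2 n3 e1 e2 e3 - clipped_volume n1 n2 n3 e1' e2' e3'|
  <= C1 * `|e1 - e1'| + C2 * `|e2 - e2'| + C3 * `|e3 - e3'|.
Proof.
have [C1 _ H1] := slab_lipschitz n1; have [C2 _ H2] := slab_lipschitz n2.
have [C3 _ H3] := slab_lipschitz n3; exists C1, C2, C3 => e1 e2 e3 e1' e2' e3'.
pose Q : set T3 := cube `&` [set q | [/\ 0 <= q.1.1, 0 <= q.1.2 & 0 <= q.2]].
have Qc : Q `<=` cube by move=> q [].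
have mQ : measurable Q.
  rewrite (_ : Q = cube); first by do 2 apply: measurableX => //; exact: measurable_itv.
  apply/seteqP; split=> // q [[h1 h2] h3]; split; first by split.
  by move: h1 h2 h3; rewrite /= !in_itv /= => /andP[-> _] /andP[-> _] /andP[-> _].
have ms n e := measurable_slab n e.
have E (S A B C : set T3) : S `&` A `&` B `&` C = S `&` (B `&` C) `&` A.
  by rewrite -!setIA (setIC A) -!setIA.
have E' (S A B C : set T3) : S `&` A `&` B `&` C = S `&` (A `&` C) `&` B.
  by rewrite -!setIA (setIC B).
have sub A : Q `&` A `<=` cube by move=> q [/Qc].
have mQ2 n e m f : measurable (Q `&` (slab n e `&` slab m f)).
  by apply: measurableI => //; exact: measurableI.
have := H1 _ e1 e1' (mQ2 n2 e2 n3 e3) (sub _); rewrite -!E => k1.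
have := H2 _ e2 e2' (mQ2 n1 e1' n3 e3) (sub _); rewrite -!E' => k2.
have := H3 _ e3 e3' (mQ2 n1 e1' n2 e2') (sub _); rewrite !setIA => k3.
rewrite /clipped_volume -/Q; move: k1 k2 k3.
set v1 := fine (vol3 (_ `&` slab n1 e1 `&` slab n2 e2 `&` slab n3 e3)).
set v2 := fine (vol3 (_ `&` slab n1 e1' `&` slab n2 e2 `&` slab n3 e3)).
set v3 := fine (vol3 (_ `&` slab n1 e1' `&` slab n2 e2' `&` slab n3 e3)).
set v4 := fine (vol3 (_ `&` slab n1 e1' `&` slab n2 e2' `&` slab n3 e3')) => k1 k2 k3.
have -> : v1 - v4 = (v1 - v2) + (v2 - v3) + (v3 - v4) by ring.
apply: le_trans (ler_normD _ _) _; apply: lerD => //.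
by apply: le_trans (ler_normD _ _) _; apply: lerD.
Qed.

Lemma clipped_volume_continuous n1 n2 n3 (f1 f2 f3 : R * R -> R) :
  continuous f1 -> continuous f2 -> continuous f3 ->
  continuous (fun x => clipped_volume n1 n2 n3 (f1 x) (f2 x) (f3 x)).
Proof.
move=> c1 c2 c3 x; have [C1 [C2 [C3 H]]] := clipped_volume_lipschitz n1 n2 n3.
pose K x' := C1 * `|f1 x - f1 x'| + C2 * `|f2 x - f2 x'| + C3 * `|f3 x - f3 x'|.
have cK : K x' @[x' --> x] --> (0 : R).
  rewrite (_ : 0 = C1 * `|f1 x - f1 x| + C2 * `|f2 x - f2 x| + C3 * `|f3 x - f3 x|); last first.
    by rewrite !subrr !normr0 !mulr0 !addr0.
  have N C (f : R * R -> R) : continuous f -> (C * `|f x - f x'|) @[x' --> x] --> C * `|f x - f x|.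
    move=> cf; apply: cvgM; first exact: cvg_cst.
    by apply: cvg_norm; apply: cvgB; [exact: cvg_cst|exact: cf].
  by apply: cvgD; [apply: cvgD|]; exact: N.
apply/cvgrPdist_lt => e e0.
have /cvgr_lt/(_ _ e0) := cK; apply: filterS => x'; exact: le_lt_trans (H _ _ _ _ _ _).
Qed.

End Continuity.

(** * From generic points to the closed triangle *)

Section Extension.
Context {R : realType}.
Variables p1 p2 p3 : R * R.
Local Notation D := (orient p1 p2 p3).
Hypothesis D0 : D != 0.

Lemma triangleP x : triangle p1 p2 p3 x <->
  [/\ 0 <= bc1 p1 p2 p3 x, 0 <= bc2 p1 p2 p3 x & 0 <= bc3 p1 p2 p3 x].
Proof.
split=> [[a [b [c [a0 b0 c0 abc ->]]]]|[a0 b0 c0]].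
  have cE : c = 1 - a - b by rewrite -abc; ring.
  have -> : bc1 p1 p2 p3 (comb3 a b c p1 p2 p3) = a.
    by rewrite /bc1 cE; move: D0; rewrite /orient /= => ?; field.
  have -> : bc2 p1 p2 p3 (comb3 a b c p1 p2 p3) = b.
    by rewrite /bc2 cE; move: D0; rewrite /orient /= => ?; field.
  have -> : bc3 p1 p2 p3 (comb3 a b c p1 p2 p3) = c.
    by rewrite /bc3 cE; move: D0; rewrite /orient /= => ?; field.
  by [].
exists (bc1 p1 p2 p3 x), (bc2 p1 p2 p3 x), (bc3 p1 p2 p3 x); split=> //; first exact: bc_sum.
transitivity (x.1, x.2); first by case: (x).
by rewrite /bc1 /bc2 /bc3 /comb3 /padd /pscale; move: D0; rewrite /orient /= => ?;
  congr (_, _); field.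
Qed.

(* On the triangle a coordinate that is constant along the fibers is nonnegative, so
   dropping its constraint does not change the fiber but makes the volume continuous. *)
Lemma spline_extension i : (i < 28)%N -> exists2 G : R * R -> R, continuous G &
  forall x, triangle p1 p2 p3 x -> simplex_spline (knots6 (nth [::] (Xis p1 p2 p3) i)) x = G x.
Proof.
move=> i28; have ok := knot_arrangements_ok i28.
move: (ok); case: (nth [::] knot_arrangements i) ok
  => [|r [|s [|t [|u [|v [|w [|]]]]]]] ok //= /and5P[/and4P[r9 s9 t9 /and4P[u9 v9 w9 _]] rst P o1 o23].
case/andP: o23 => o2 o3.
pose r' := knot p1 p2 p3 r; pose s' := knot p1 p2 p3 s; pose t' := knot p1 p2 p3 t.
pose u' := knot p1 p2 p3 u; pose v' := knot p1 p2 p3 v; pose w' := knot p1 p2 p3 w.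
have nz k : k != 0 -> k%:~R / 27 * D != 0 :> R.
  by move=> k0; rewrite !mulf_neq0 ?intr_eq0 // invr_eq0 pnatr_eq0.
have D' : orient r' s' t' != 0 by rewrite orient_knot // nz.
(* A vanishing normal excludes a free knot with nonzero coordinate, so the other alternative of
   [coordinate_ok] holds and the vertex signs give nonnegativity. *)
have vert (f : R * R -> R) (g : nat -> int) : coordinate_ok (knot_det r s t) g [:: u; v; w] ->
    affine_fun f ->
    (forall k, (k < 9)%N -> f (knot p1 p2 p3 k) = (g k)%:~R / (knot_det r s t)%:~R) ->
    forall x, triangle p1 p2 p3 x -> nv f u' v' w' = 0 -> 0 <= f x.
  move=> /orP[/hasP[k kin gk]|/and4P[g0 g3 g6 _]] [a [b [c fE]]] fg x tx n0.
    have : f (knot p1 p2 p3 k) = 0.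
      case: n0 => n1 n2 n3; move: kin; rewrite !inE => /or3P[] /eqP ->;
      [exact: n1|exact: n2|exact: n3].
    have k9 : (k < 9)%N by move: kin; rewrite !inE => /or3P[] /eqP ->.
    by rewrite fg // => /eqP; rewrite mulf_eq0 invr_eq0 !intr_eq0 (negPf gk) (negPf rst).
  have pos k : (k < 9)%N -> (0 <= g k * knot_det r s t)%R -> 0 <= f (knot p1 p2 p3 k).
    move=> k9 gk; rewrite fg //.
    have -> : (g k)%:~R / (knot_det r s t)%:~R
        = (g k * knot_det r s t)%:~R / (knot_det r s t)%:~R ^+ 2 :> R.
      by rewrite intrM; field; rewrite intr_eq0.
    by rewrite divr_ge0 ?sqr_ge0// ler0z.
  have h1 : 0 <= f p1 by exact: (pos 0%N).
  have h2 : 0 <= f p2 by exact: (pos 3%N).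
  have h3 : 0 <= f p3 by exact: (pos 6%N).
  have [x1 x2 x3] := (triangleP x).1 tx.
  have -> : f x = bc1 p1 p2 p3 x * f p1 + bc2 p1 p2 p3 x * f p2 + bc3 p1 p2 p3 x * f p3.
    rewrite !fE /bc1 /bc2 /bc3; move: D0; rewrite /orient => ?; field; by [].
  by rewrite !addr_ge0// mulr_ge0.
have gen (g k : int) : (k%:~R / 27 * D) / (g%:~R / 27 * D) = k%:~R / g%:~R :> R.
  have [->|g0] := eqVneq g 0; first by rewrite mulr0z !mul0r invr0 !mulr0.
  by field; rewrite D0 intr_eq0 g0.
have [a1 a2 a3] := bc_affine r' s' t'.
have q1 := vert _ _ o1 a1 (fun k k9 => etrans (congr2 (fun y z => y / z)
  (orient_knot p1 p2 p3 k9 s9 t9) (orient_knot p1 p2 p3 r9 s9 t9)) (gen _ _)).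
have q2 := vert _ _ o2 a2 (fun k k9 => etrans (congr2 (fun y z => y / z)
  (orient_knot p1 p2 p3 r9 k9 t9) (orient_knot p1 p2 p3 r9 s9 t9)) (gen _ _)).
have q3 := vert _ _ o3 a3 (fun k k9 => etrans (congr2 (fun y z => y / z)
  (orient_knot p1 p2 p3 r9 s9 k9) (orient_knot p1 p2 p3 r9 s9 t9)) (gen _ _)).
pose n1 := nv (bc1 r' s' t') u' v' w'; pose n2 := nv (bc2 r' s' t') u' v' w'.
pose n3 := nv (bc3 r' s' t') u' v' w'.
exists (fun x => 120 / `|orient r' s' t'| *
    clipped_volume n1 n2 n3 (bc1 r' s' t' x) (bc2 r' s' t' x) (bc3 r' s' t' x)).
  move=> x; apply: cvgM; first exact: cvg_cst.
  by apply: clipped_volume_continuous; exact: affine_continuous.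
move=> x tx; rewrite (nth_Xis _ _ _ i28) (spline_arrangement D0 x ok) /= spline_eval //.
congr (_ * fine (vol3 _)); apply/seteqP; split=> q.
  move=> Fq; have Cq := fiber_sub_cube D' Fq; case: Fq => Pq [f1 f2 f3].
  by split; [split; [split; [split|]|]|]; rewrite // /slab /=; right.
have pick n e : slab n e q -> (n = 0 -> 0 <= e) -> lin3 n q <= e.
  by move=> [->|//] /(_ erefl); rewrite /lin3 !mul0r !addr0.
move=> [[[[_ Pq] f1] f2] f3]; split=> //; split; apply: pick => //.
- exact: q1.
- exact: q2.
- exact: q3.
Qed.

(** Lying in the closure of the interior makes the interior trace of the neighbourhood filter
    proper, so the boundary limit is unique and is computed with the continuous extension. *)
Lemma spline_continuous_on_triangle i x : (i < 28)%N -> triangle p1 p2 p3 x ->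
  closure (interior (triangle p1 p2 p3)) x ->
  Bsp p1 p2 p3 i x
  = wt p1 p2 p3 i * simplex_spline (knots6 (nth [::] (Xis p1 p2 p3) i)) x.
Proof.
move=> i28 tx cx; rewrite /Bsp /restrict_cont; case: asboolP => // _.
have [G cG GE] := spline_extension i28.
rewrite GE //; apply: cvg_lim => //.
apply: (@cvg_trans _ ((fun x' => wt p1 p2 p3 i * G x') @ within (interior (triangle p1 p2 p3)) (nbhs x))).
  apply: fmap_within_eq => x' /set_mem /interior_subset tx'.
  by rewrite GE.
by apply: cvg_within_filter; apply: cvgM; [exact: cvg_cst|exact: cG].
Qed.

(* The weights 1 : 5 : 27 put this point off every line through two of the nine knots. *)
Let inner : R * R := ((p1.1 + 5 * p2.1 + 27 * p3.1) / 33, (p1.2 + 5 * p2.2 + 27 * p3.2) / 33).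

Definition inner_det (b c : nat) : int :=
  let: (b1, b2, b3) := knot_weights b in let: (c1, c2, c3) := knot_weights c in
  1 * (b2 * c3 - b3 * c2) - 5%Z * (b1 * c3 - b3 * c1) + 27%Z * (b1 * c2 - b2 * c1).

Lemma inner_det_neq0 : all (fun b => all (fun c => (b == c) || (inner_det b c != 0)) (iota 0 9)) (iota 0 9).
Proof. by vm_compute. Qed.

Lemma inner_generic : generic p1 p2 p3 inner.
Proof.
move=> b c b9 c9 bc.
have : inner_det b c != 0.
  have /allP/(_ b) := inner_det_neq0; rewrite mem_iota => /(_ b9) /allP /(_ c).
  by rewrite mem_iota => /(_ c9) /orP[|//]; rewrite (negPf bc).
move: (@knotE _ p1 p2 p3 b b9) (@knotE _ p1 p2 p3 c c9); rewrite /inner_det.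
case: (knot_weights b) => [[b1 b2] b3]; case: (knot_weights c) => [[c1 c2] c3].
move=> [B1 B2 B3] [C1 C2 C3]; rewrite -(intr_eq0 R); apply: contraNN => /eqP O.
(* The factor 297 = 33 * 3 * 3 clears the denominators of [inner] and of the two knots. *)
have : orient inner (knot p1 p2 p3 b) (knot p1 p2 p3 c) * 297 / D = 0 by rewrite O !mul0r.
rewrite /orient B1 B2 C1 C2 /inner !(intrD, mulrNz, intrM) /=.
have -> : b3%:~R = 3 - b1%:~R - b2%:~R :> R by rewrite -B3; ring.
have -> : c3%:~R = 3 - c1%:~R - c2%:~R :> R by rewrite -C3; ring.
by move=> <-; apply/eqP; move: D0; rewrite /orient => ?; field.
Qed.

Let path (x : R * R) (e : R) : R * R :=
  (x.1 + e * (inner.1 - x.1), x.2 + e * (inner.2 - x.2)).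

Lemma path_affine f x e : affine_fun f -> f (path x e) = f x + e * (f inner - f x).
Proof. by move=> [a [b [c fE]]]; rewrite !fE /path /=; ring. Qed.

Lemma path_cvg x : path x e @[e --> 0^'+] --> x.
Proof.
have K (a b : R) : a + e * (b - a) @[e --> 0^'+] --> a.
  suff : a + e * (b - a) @[e --> 0^'+] --> a + 0 * (b - a) by rewrite mul0r addr0.
  apply: cvg_at_right_filter; apply: cvgD; first exact: cvg_cst.
  by apply: cvgM; [exact: cvg_id|exact: cvg_cst].
rewrite [x in _ --> x](_ : x = (x.1, x.2)); last by case: (x).
exact: (cvg_pair (K x.1 inner.1) (K x.2 inner.2)).
Qed.

Lemma inner_bc : [/\ 0 < bc1 p1 p2 p3 inner, 0 < bc2 p1 p2 p3 inner & 0 < bc3 p1 p2 p3 inner].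
Proof.
have -> : bc1 p1 p2 p3 inner = 1 / 33.
  by rewrite /bc1 /inner; move: D0; rewrite /orient /= => ?; field.
have -> : bc2 p1 p2 p3 inner = 5 / 33.
  by rewrite /bc2 /inner; move: D0; rewrite /orient /= => ?; field.
have -> : bc3 p1 p2 p3 inner = 27 / 33.
  by rewrite /bc3 /inner; move: D0; rewrite /orient /= => ?; field.
by split; rewrite divr_gt0.
Qed.

Lemma path_interior x e : triangle p1 p2 p3 x -> 0 < e -> e < 1 ->
  interior (triangle p1 p2 p3) (path x e).
Proof.
move=> /triangleP[x1 x2 x3] e0 e1; have [i1 i2 i3] := inner_bc.
have [a1 a2 a3] := bc_affine p1 p2 p3.
have pos f : affine_fun f -> 0 <= f x -> 0 < f inner -> \forall x' \near path x e, 0 < f x'.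
  move=> af fx fi.
  have H : 0 < f (path x e).
    rewrite path_affine // (_ : _ + _ = (1 - e) * f x + e * f inner); last by ring.
    by rewrite ltr_wpDl ?mulr_gt0 // mulr_ge0 // subr_ge0 ltW.
  by have /cvgr_gt/(_ _ H) := affine_continuous af (x := path x e).
have P1 := pos _ a1 x1 i1; have P2 := pos _ a2 x2 i2; have P3 := pos _ a3 x3 i3.
rewrite /interior /=; near=> x'; apply/triangleP; split; apply/ltW; near: x'.
- exact: P1.
- exact: P2.
- exact: P3.
Unshelve. all: by end_near. Qed.

Lemma path_near_interior x : triangle p1 p2 p3 x ->
  \forall e \near 0^'+, interior (triangle p1 p2 p3) (path x e).
Proof.
move=> tx; near=> e.
have e0 : 0 < e by near: e; exact: nbhs_right_gt.
have e1 : e < 1 by near: e; exact: nbhs_right_lt.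
exact: path_interior.
Unshelve. all: by end_near. Qed.

(** Along the segment from [x] to [inner] each [orient] is affine in [e] and nonzero at [e = 1], so
    it has at most one zero; finitely many lines leave all small positive [e] free. *)
Lemma path_near_generic x : \forall e \near 0^'+, generic p1 p2 p3 (path x e).
Proof.
have one k l : (k < 9)%N -> (l < 9)%N -> k != l ->
    \forall e \near (0 : R)^'+, orient (path x e) (knot p1 p2 p3 k) (knot p1 p2 p3 l) != 0.
  move=> k9 l9 kl; set s := knot _ _ _ k; set t := knot _ _ _ l.
  have B0 : orient inner s t != 0 by exact: inner_generic.
  have [A0|A0] := eqVneq (orient x s t) 0.
    near=> e; rewrite (path_affine _ _ (orient_affine s t)) A0 add0r subr0 mulf_neq0 //.
  (* Below [c] the change of [orient] along the path is smaller than its value at [x]; the added 1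
     avoids a zero denominator. *)
  pose c := `|orient x s t| / (`|orient inner s t - orient x s t| + 1).
  have p0 : 0 < `|orient inner s t - orient x s t| + 1 by rewrite ltr_wpDl.
  have c0 : 0 < c by rewrite divr_gt0 // normr_gt0.
  near=> e; rewrite (path_affine _ _ (orient_affine s t)).
  have e0 : 0 < e by near: e; exact: nbhs_right_gt.
  have ec : e < c by near: e; exact: nbhs_right_lt.
  apply/eqP => /eqP; rewrite addr_eq0 => /eqP/(congr1 Num.norm).
  rewrite normrN normrM (gtr0_norm e0) => E.
  move: ec; rewrite /c ltr_pdivlMr // E mulrDr mulr1.
  by rewrite gtrDl ltNge ltW.
(* Indexing by the finite type of pairs allows the near statements to be intersected. *)
have : \forall e \near (0 : R)^'+, forall kl : 'I_9 * 'I_9, kl.1 != kl.2 ->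
    orient (path x e) (knot p1 p2 p3 kl.1) (knot p1 p2 p3 kl.2) != 0.
  apply: filter_forall => -[k l] /=.
  have [->|kl] := eqVneq k l; first by near=> e.
  by have := one k l (ltn_ord k) (ltn_ord l) kl; apply: filterS.
apply: filterS => e H k l k9 l9 kl.
exact: (H (Ordinal k9, Ordinal l9)).
Unshelve. all: by end_near. Qed.

Lemma triangle_closure x : triangle p1 p2 p3 x -> closure (interior (triangle p1 p2 p3)) x.
Proof.
move=> tx B Bx.
have H : \forall e \near (0 : R)^'+, interior (triangle p1 p2 p3) (path x e) /\ B (path x e).
  by apply: filterI; [exact: path_near_interior|exact: (path_cvg Bx)].
near (0 : R)^'+ => e; exists (path x e).
by near: e.
Unshelve. all: by end_near. Qed.

Lemma marsden_triangle x y : triangle p1 p2 p3 x ->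
  (1 + dot y x) ^+ 3 = \sum_(i < 28) psi p1 p2 p3 i y * Bsp p1 p2 p3 i x.
Proof.
move=> tx.
have /choice[G HG] : forall i : 'I_28, exists G : R * R -> R, continuous G /\
    forall x, triangle p1 p2 p3 x -> simplex_spline (knots6 (nth [::] (Xis p1 p2 p3) i)) x = G x.
  by move=> i; have [G cG GE] := spline_extension (ltn_ord i); exists G.
pose F x' := (1 + dot y x') ^+ 3 - \sum_(i < 28) psi p1 p2 p3 i y * (wt p1 p2 p3 i * G i x').
have cF : continuous F.
  move=> x'; apply: cvgB.
    have ad : affine_fun (fun x' => 1 + dot y x').
      by exists y.1, y.2, 1 => z; rewrite /dot; ring.
    have cd := affine_continuous ad (x := x').
    apply: (@cvg_comp _ _ _ (fun z => 1 + dot y z) (fun z : R => z ^+ 3) _ _ _ cd).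
    exact: exprn_continuous.
  apply: cvg_big => [|i _]; first exact: add_continuous.
  apply: cvgM; first exact: cvg_cst.
  by apply: cvgM; [exact: cvg_cst|exact: (HG i).1].
have F0 : \forall e \near (0 : R)^'+, F (path x e) = 0.
  near=> e.
  have te : triangle p1 p2 p3 (path x e).
    by apply: interior_subset; near: e; exact: path_near_interior.
  have ge : generic p1 p2 p3 (path x e) by near: e; exact: path_near_generic.
  have [e1 e2 e3] := (triangleP _).1 te.
  rewrite /F (marsden_generic D0 y ge e1 e2 e3) -sumrB big1 // => i _.
  by rewrite (HG i).2 // subrr.
have Cx : F (path x e) @[e --> (0 : R)^'+] --> F x.
  move=> A /(cF x); exact: path_cvg.
have C0 : F (path x e) @[e --> (0 : R)^'+] --> (0 : R) by exact: cvg_near_cst.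
have Fx : F x = 0 by exact: (cvg_unique _ Cx C0).
move/eqP: Fx; rewrite subr_eq0 => /eqP ->; apply: eq_bigr => i _.
by rewrite (spline_continuous_on_triangle (ltn_ord i) tx (triangle_closure tx)) (HG i).2.
Unshelve. all: by end_near. Qed.

End Extension.

Theorem theorem3p5 (R : realType) (p1 p2 p3 : R * R) :
  0 < tri_area p1 p2 p3 ->
  forall y x : R * R, triangle p1 p2 p3 x ->
  (1 + dot y x) ^+ 3 = \sum_(i < 28) psi p1 p2 p3 i y * Bsp p1 p2 p3 i x.
Proof.
move=> a0 y x; apply: marsden_triangle.
by apply: contraTneq a0 => D0; rewrite /tri_area -[X in `|X|]/(orient p1 p2 p3) D0 normr0 mul0r ltxx.
Qed.
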